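(* Let $\Omega\subset\mathbb{R}^n$ be a bounded convex domain. Then there exists a positive constant $C(n)>0$, depending only on the dimension $n$, such that for any $u\in H_0^1(\Omega)$, $$\int_\Omega F(\nabla u)^2\,dx-\frac14\int_\Omega\frac{|u|^2}{d_F^2}\,dx\;\ge\;C(n)\,|\Omega|^{-\frac2n}\int_\Omega|u|^2\,dx,$$ where $d_F$ is the anisotropic distance function to $\partial\Omega$ and $|\Omega|$ is the Lebesgue measure of $\Omega$.
   Context: Standing assumptions on $F$: $F:\mathbb{R}^n\to[0,+\infty)$ is convex, satisfies $F(t\xi)=|t|F(\xi)$ for all $t\in\mathbb{R}$, $\xi\in\mathbb{R}^n$, and $\alpha_1|\xi|\le F(\xi)$ for all $\xi\in\mathbb{R}^n$, for some constant $\alpha_1>0$; moreover $F\in C^2(\mathbb{R}^n\setminus\{0\})$ and the Hessian $\nabla^2_\xi F^2$ is positive definite on $\mathbb{R}^n\setminus\{0\}$. Polar function: $F^o(x)=\sup_{\xi\ne0}\frac{\xi\cdot x}{F(\xi)}$, $x\in\mathbb{R}^n$. A domain is a connected open set with non-empty boundary. The anisotropic distance to the boundary of $\Omega$ is $d_F(x)=\inf_{y\in\partial\Omega}F^o(x-y)$, $x\in\overline\Omega$.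
   Formalization: The constant depends on n and on the coercivity constant alpha_1 of F, not on n alone: replacing F by tF multiplies the left side by t^2 and leaves the right side unchanged, so no constant depending only on n can serve every F. It is independent of Omega and u. *)

(* Defs.v *)
From HB Require Import structures.
From mathcomp Require Import all_boot all_order all_algebra.
From mathcomp Require Import all_classical all_reals all_analysis.

Set Implicit Arguments.
Unset Strict Implicit.
Unset Printing Implicit Defensive.
Import Order.TTheory GRing.Theory Num.Theory.
Import numFieldNormedType.Exports.

Local Open Scope classical_set_scope.
Local Open Scope ring_scope.

(** ** Lebesgue measure on R^n *)

(* R^n is ['rV[R]_n]; its sigma-algebra is generated by the coordinate maps,
   hence is the Borel sigma-algebra. *)
Section measurable_rV.
Context {R : realType}.
Variable n : nat.

Let coors : 'I_n -> 'rV[R]_n -> measurableTypeR R := fun i x => x ord0 i.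

Let rV_set0 : g_sigma_preimage coors set0.
Proof. exact: sigma_algebra0. Qed.

Let rV_setC A : g_sigma_preimage coors A -> g_sigma_preimage coors (~` A).
Proof. exact: sigma_algebraC. Qed.

Let rV_bigcup (A : (set _)^nat) : (forall i, g_sigma_preimage coors (A i)) ->
  g_sigma_preimage coors (\bigcup_i (A i)).
Proof. exact: sigma_algebra_bigcup. Qed.

HB.instance Definition _ :=
  @isMeasurable.Build default_measure_display 'rV[R]_n
    (g_sigma_preimage coors) rV_set0 rV_setC rV_bigcup.

Lemma measurable_fun_rVP d (T : measurableType d) (f : T -> 'rV[R]_n) :
  measurable_fun [set: T] f <->
  forall i, measurable_fun [set: T] (coors i \o f).
Proof.
apply: (@iff_trans _ (g_sigma_preimage (fun i => coors i \o f) `<=` measurable)).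
  rewrite g_sigma_preimage_comp; split=> [mf A [/= C preC <-]|prefS].
    exact: mf.
  by move=> _ A mA; apply: prefS; exists A.
split=> [tnthfS i|mf].
- move=> _ A mA.
  apply: tnthfS; apply: sub_sigma_algebra.
  case: n i @coors rV_set0 rV_setC rV_bigcup f => [[] []//|n' i coors' _ _ _ f].
  rewrite -bigcup_mkord_ord.
  exists i; first exact: ltn_ord.
  by exists A => //; rewrite inord_val.
- apply: smallest_sub; first exact: sigma_algebra_measurable.
  case: n @coors rV_set0 rV_setC rV_bigcup f mf => [|n'] coors' _ _ _ f mf.
    by rewrite big_ord0.
  rewrite -bigcup_mkord_ord; apply: bigcup_sub => i Ii.
  by move=> A [B mB <-]; exact: mf.
Qed.

Lemma measurable_rV_coord (i : 'I_n) : measurable_fun [set: 'rV[R]_n] (coors i).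
Proof. by have /measurable_fun_rVP := @measurable_id _ 'rV[R]_n setT; exact. Qed.

End measurable_rV.

Section lebesgue_rV.
Context {R : realType}.

Definition rV_cons n (p : measurableTypeR R * 'rV[R]_n) : 'rV[R]_n.+1 :=
  row_mx (p.1%:M : 'M[R]_1) p.2.

(* n-dimensional Lebesgue measure, as the iterated product of the
   one-dimensional one; [lebesgue_rV_box] below computes it on boxes. *)
Fixpoint lebesgue_rV (n : nat) : set 'rV[R]_n -> \bar R :=
  match n with
  | 0 => fun A => \d_(0 : 'rV[R]_0) A
  | n'.+1 => pushforward (lebesgue_measure \x @lebesgue_rV n')%E (@rV_cons n')
  end.

Let rV_uncons n (x : 'rV[R]_n.+1) : measurableTypeR R * 'rV[R]_n :=
  (x ord0 ord0, rsubmx (x : 'rV[R]_(1 + n))).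

Let rV_consK n : cancel (@rV_cons n) (@rV_uncons n).
Proof.
case=> a y; rewrite /rV_uncons /rV_cons /=; congr pair; last exact: row_mxKr.
rewrite (_ : ord0 = lshift n (ord0 : 'I_1)); last exact: val_inj.
by apply: etrans (row_mxEl _ _ _ _) _; rewrite mxE eqxx.
Qed.

Lemma measurable_rV_cons n : measurable_fun setT (@rV_cons n).
Proof.
apply/measurable_fun_rVP => i.
have [j ->|j ->] := @split_ordP 1 n i.
  rewrite [X in measurable_fun _ X](_ : _ = fst)//.
  apply/funext => p /=.
  by apply: etrans (row_mxEl _ _ _ _) _; rewrite mxE (ord1 j).
rewrite [X in measurable_fun _ X](_ : _ =
    (fun x : 'rV[R]_n => x ord0 j : measurableTypeR R) \o snd).
  by apply: measurableT_comp => //; exact: measurable_rV_coord.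
by apply/funext => p /=; apply: etrans (row_mxEr _ _ _ _) _.
Qed.

Let measurable_rV_uncons n : measurable_fun setT (@rV_uncons n).
Proof.
apply: measurable_fun_pair; first exact: measurable_rV_coord.
apply/measurable_fun_rVP => i.
rewrite [X in measurable_fun _ X](_ : _ =
    (fun x : 'rV[R]_n.+1 => x ord0 (rshift 1 i : 'I_n.+1) : measurableTypeR R)).
  exact: measurable_rV_coord.
by apply/funext => x /=; rewrite mxE.
Qed.

Let lebesgue_rV_ex n :
  {m : {sigma_finite_measure set 'rV[R]_n -> \bar R} |
    m = @lebesgue_rV n :> (_ -> _)}.
Proof.
elim: n => [|n [m mE]] /=; first by exists (@dirac _ 'rV[R]_0 0 R).
rewrite -mE.
pose M : {measure set (measurableTypeR R * 'rV[R]_n)%type -> \bar R} :=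
  (lebesgue_measure \x m)%E.
have Mfin : sigma_finite setT M.
  have /sigma_finiteP[F [TF ndF Foo]] := sigma_finiteT (@lebesgue_measure R).
  have /sigma_finiteP[G [TG ndG Goo]] := sigma_finiteT m.
  exists (fun k => F k `*` G k).
    rewrite -setXTT TF TG predeqE => -[x y]; split.
      move=> [/= [i _ Fx] [k _ Gy]]; exists (maxn i k) => //; split.
      - by move: x Fx; exact/subsetPset/ndF/leq_maxl.
      - by move: y Gy; exact/subsetPset/ndG/leq_maxr.
    by move=> [k _ []/= ? ?]; split; exists k.
  move=> k; have [? ?] := Foo k; have [? ?] := Goo k.
  split; first exact: measurableX.
  by rewrite /M /= product_measure1E// lte_mul_pinfty// ge0_fin_numE.
set P := pushforward _ _.
have PE : P = pushforward M (@rV_cons n) by [].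
have P0 : P set0 = 0%E by rewrite PE /pushforward preimage_set0 measure0.
have Pge0 A : (0 <= P A)%E by rewrite PE; exact: (measure_ge0 M).
have mP A : measurable A -> measurable (@rV_cons n @^-1` A).
  by move=> mA; rewrite -[X in measurable X]setTI; exact: measurable_rV_cons.
have Psigma : semi_sigma_additive P.
  move=> F mF tF mUF; rewrite PE /pushforward preimage_bigcup.
  apply: measure_semi_sigma_additive.
  - by move=> k; exact: mP.
  - apply/trivIsetP => /= i j _ _ ij; rewrite -preimage_setI.
    by move/trivIsetP : tF => /(_ _ _ _ _ ij) ->//; rewrite preimage_set0.
  - by rewrite -preimage_bigcup; exact: mP.
have Pfin : sigma_finite setT P.
  have [F TF Foo] := Mfin.
  exists (fun k => @rV_uncons n @^-1` F k).
    by rewrite -preimage_bigcup -TF preimage_setT.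
  move=> k; have [mF Fk] := Foo k; split.
    by rewrite -[X in measurable X]setTI; exact: measurable_rV_uncons.
  rewrite PE /pushforward -comp_preimage (_ : _ \o _ = id)//.
  by apply/funext => x; exact: rV_consK.
move: P {PE} P0 Pge0 Psigma Pfin => P P0 Pge0 Psigma Pfin.
pose P1 := isMeasure.Build _ _ _ P P0 Pge0 Psigma.
pose P2 := Measure_isSigmaFinite.Build _ _ _
  (HB.pack_for {measure set 'rV[R]_n.+1 -> \bar R} P P1) Pfin.
by exists (HB.pack_for {sigma_finite_measure set 'rV[R]_n.+1 -> \bar R} P P1 P2).
Qed.

Let lebesgue_rV0 n : @lebesgue_rV n set0 = 0%E.
Proof. by case: (lebesgue_rV_ex n) => m <-; exact: measure0. Qed.

Let lebesgue_rV_ge0 n A : (0 <= @lebesgue_rV n A)%E.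
Proof. by case: (lebesgue_rV_ex n) => m <-; exact: measure_ge0. Qed.

Let lebesgue_rV_sigma_additive n : semi_sigma_additive (@lebesgue_rV n).
Proof.
by case: (lebesgue_rV_ex n) => m <-; exact: measure_semi_sigma_additive.
Qed.

HB.instance Definition _ n := isMeasure.Build _ _ _ (@lebesgue_rV n)
  (lebesgue_rV0 n) (@lebesgue_rV_ge0 n) (@lebesgue_rV_sigma_additive n).

Let lebesgue_rV_sigma_finite n : sigma_finite setT (@lebesgue_rV n).
Proof. by case: (lebesgue_rV_ex n) => m <-; exact: sigma_finiteT. Qed.

HB.instance Definition _ n := Measure_isSigmaFinite.Build _ _ _
  (@lebesgue_rV n) (@lebesgue_rV_sigma_finite n).

Lemma lebesgue_rV_box n (A : 'I_n -> set (measurableTypeR R)) :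
  (forall i, measurable (A i)) ->
  @lebesgue_rV n [set x | forall i, A i (x ord0 i)] =
  (\prod_(i < n) lebesgue_measure (A i))%E.
Proof.
elim: n A => [|n IH] A mA.
  rewrite big_ord0 /= diracE mem_set// => -[].
  by case.
rewrite big_ord_recl /= /pushforward -IH; last by move=> i; exact: mA.
have mB : measurable [set x : 'rV[R]_n | forall i, A (lift ord0 i) (x ord0 i)].
  rewrite (_ : mkset _ = \bigcap_(i in [set: 'I_n])
      ((fun x : 'rV[R]_n => x ord0 i : measurableTypeR R) @^-1` A (lift ord0 i))).
    apply: fin_bigcap_measurable => // i _.
    by rewrite -[X in measurable X]setTI; exact: measurable_rV_coord.
  by apply/seteqP; split => x /= h i; [move=> _|]; exact: h.
rewrite -product_measure1E//.
have E1 a (y : 'rV[R]_n) : rV_cons (a, y) ord0 ord0 = a.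
  by have := congr1 fst (rV_consK (a, y)).
have E2 a (y : 'rV[R]_n) i : rV_cons (a, y) ord0 (lift ord0 i) = y ord0 i.
  rewrite (_ : lift ord0 i = rshift 1 i); last exact: val_inj.
  by apply: etrans (row_mxEr _ _ _ _) _.
congr product_measure1; apply/seteqP; split => -[a y] /= h.
  by split => [|i]; [rewrite -(E1 a y)|rewrite -(E2 a y)]; exact: h.
move=> i; have [j ->|->] := @fintype.unliftP _ ord0 i.
  by rewrite E2; exact: h.2.
by rewrite E1; exact: h.1.
Qed.

End lebesgue_rV.

Arguments lebesgue_rV {R} n A.

(** ** Calculus on R^n *)

Section calculus.
Context {R : realType} {n : nat}.
Implicit Types (x y : 'rV[R]_n) (U : set 'rV[R]_n) (f : 'rV[R]_n -> R).

Definition dot x y : R := \sum_(i < n) x ord0 i * y ord0 i.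

(* The library norm on ['rV[R]_n] is the sup norm. *)
Definition enorm x : R := Num.sqrt (dot x x).

Definition partial (i : 'I_n) f : 'rV[R]_n -> R :=
  fun x => 'D_(delta_mx ord0 i) f x.

Definition grad f x : 'rV[R]_n := \row_i partial i f x.

Definition hessian f x : 'M[R]_n :=
  \matrix_(i, j) partial i (partial j f) x.

Definition posdef_mx (A : 'M[R]_n) : Prop :=
  forall v : 'rV[R]_n, v != 0 -> 0 < dot (v *m A) v.

(* f is of class C^k on the open set U: its partial derivatives of order at
   most k exist and are continuous on U. *)
Fixpoint Ck (k : nat) U f : Prop :=
  (forall x, U x -> {for x, continuous f}) /\
  match k with
  | 0 => True
  | k'.+1 => forall i : 'I_n,
      (forall x, U x -> derivable f x (delta_mx ord0 i)) /\
      Ck k' U (partial i f)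
  end.

Definition boundary U : set 'rV[R]_n := closure U `\` interior U.

Definition domain U : Prop := [/\ open U, connected U & boundary U !=set0].

End calculus.

(** ** The space H^1_0 *)

Section sobolev.
Context {R : realType} {n : nat}.
Notation mu := (lebesgue_rV n).
Implicit Types (Omega : set 'rV[R]_n) (u : 'rV[R]_n -> R)
  (Du : 'rV[R]_n -> 'rV[R]_n).

(* C_c^oo(Omega), the functions being extended by 0 outside Omega. *)
Definition test_function Omega (phi : 'rV[R]_n -> R) : Prop :=
  [/\ forall k, Ck k setT phi,
      compact (closure [set x | phi x != 0]) &
      closure [set x | phi x != 0] `<=` Omega].

Definition L2 Omega u : Prop :=
  measurable_fun Omega u /\ (\int[mu]_(x in Omega) (u x ^+ 2)%:E < +oo)%E.

(* u is in H^1(Omega) and Du is (a representative of) its weak gradient; only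
   the values of u and Du on Omega matter. *)
Definition H1 Omega u Du : Prop :=
  [/\ L2 Omega u,
      forall i, L2 Omega (fun x => Du x ord0 i) &
      forall phi, test_function Omega phi -> forall i,
        (\int[mu]_(x in Omega) (u x * partial i phi x)%:E =
         - \int[mu]_(x in Omega) (Du x ord0 i * phi x)%:E)%E].

(* u is in H^1_0(Omega), the closure of C_c^oo(Omega) in H^1(Omega), and Du is
   its weak gradient. *)
Definition H10 Omega u Du : Prop :=
  H1 Omega u Du /\
  exists phi_ : nat -> 'rV[R]_n -> R,
    (forall k, test_function Omega (phi_ k)) /\
    (\int[mu]_(x in Omega)
       ((phi_ k x - u x) ^+ 2 + enorm (grad (phi_ k) x - Du x) ^+ 2)%:E)%E
      @[k --> \oo] --> 0%E.

End sobolev.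

(** ** Anisotropic norms *)

Section anisotropic.
Context {R : realType} {n : nat}.
Implicit Types (F : 'rV[R]_n -> R) (Omega : set 'rV[R]_n).

Record anisotropic_norm (alpha1 : R) F : Prop := AnisotropicNorm {
  anisotropic_ge0 : forall xi, 0 <= F xi ;
  anisotropic_convex : convex_function setT F ;
  anisotropic_homogeneous : forall t xi, F (t *: xi) = `|t| * F xi ;
  anisotropic_coercive : forall xi, alpha1 * enorm xi <= F xi ;
  anisotropic_C2 : Ck 2 [set xi | xi != 0] F ;
  anisotropic_hessian : forall xi, xi != 0 ->
    posdef_mx (hessian (fun zeta => F zeta ^+ 2) xi)
}.

Definition polar F (x : 'rV[R]_n) : R :=
  sup [set dot xi x / F xi | xi in [set xi | xi != 0]].

Definition anisotropic_dist F Omega (x : 'rV[R]_n) : R :=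
  inf [set polar F (x - y) | y in boundary Omega].

End anisotropic.

(* Main.v *)
From HB Require Import structures.
Require Import Defs.
From mathcomp Require Import all_boot all_order all_algebra.
From mathcomp Require Import all_classical all_reals all_analysis.
From mathcomp Require Import measurable_realfun.
From mathcomp Require Import ring lra.
Import Order.TTheory GRing.Theory Num.Theory.
Import numFieldNormedType.Exports.
Local Open Scope classical_set_scope.
Local Open Scope ring_scope.
Set Implicit Arguments.
Unset Strict Implicit.
Unset Printing Implicit Defensive.

(** Let d be the anisotropic distance to the boundary of Omega.  Since Omega is
    convex, d is on Omega the infimum of the affine functions
    l(x) = nu . x - c which are positive on Omega and normalized by F(nu) = 1
    ([supporting_halfspace]).  With such an l comes the direction
    e = grad F(nu): it satisfies |xi . e| <= F(xi) for all xi and nu . e = 1, so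
    that F(grad u)^2 >= (D_e u)^2 while l grows at unit speed along e.

    Take finitely many such functions l_i, with directions e_i, and cut space
    into the cells where l_i is the smallest.  Along e_i the function l_i grows
    at speed 1 and every other l_j at speed nu_j . e_i <= F(nu_j) = 1, so a point
    of the i-th cell stays in it when it moves backwards along e_i.  On such a
    set A, translation invariance of Lebesgue measure gives
    int_A D_e g >= 0 for every nonnegative compactly supported C^1 function g
    ([flux_ge0]).  For g = u^2 h(l) with a positive slope h this reads
      int_A (2 u D_e u h(l) + u^2 h'(l)) >= 0,
    and completing the square yields
      int_A F(grad u)^2 >= int_A W(l) u^2,    W = - h' - h^2
    ([cell_hardy]).  The slope h(t) = 1/(2t) - 1/(2(t+L)) makes W decreasing,
    with W(t) >= 1/(4 t^2) + 1/(16 L^2) for 0 < t <= L ([hardy_weight_ge]).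

    For a test function u and eta > 0, compactness of the support provides
    finitely many l_i with min l_i <= d + eta on it; summing over the cells,
      int F(grad u)^2 >= int W(d + eta) u^2
    ([hardy_test]).  The weight W(d + eta) is bounded, so the inequality passes
    to H^1_0 ([H10_weighted_le]); eta is then sent to 0 by Fatou's lemma
    ([hardy_H10]).  Finally coercivity of F forces Omega to contain a cube
    centred at x with side proportional to d(x), so that d is at most a multiple
    of |Omega|^(1/n) ([aniso_dist_le_volume]), and L can be chosen of that
    order. *)

(** * Borel sets and translation invariance in R^n *)

Section measurability.
Context {R : realType} {n : nat}.

Lemma measurable_coord (i : 'I_n) :
  measurable_fun setT (fun x : 'rV[R]_n => x ord0 i : R).
Proof. exact: (@measurable_rV_coord R n i). Qed.

Lemma measurable_ball_rV (x : 'rV[R]_n) (e : R) : 0 < e ->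
  measurable (ball x e).
Proof.
move=> e0.
rewrite (_ : ball x e = \bigcap_(i in [set: 'I_n])
    ((fun y : 'rV[R]_n => y ord0 i : R) @^-1` ball (x ord0 i) e)).
  apply: fin_bigcap_measurable => // i _.
  by rewrite -[X in measurable X]setTI; apply: measurable_coord => //;
    exact: measurable_ball.
apply/seteqP; split => y /=.
  by move=> [_ xy] i _; exact: xy.
by move=> xy; split => // i j; rewrite (ord1 i); exact: xy.
Qed.

(** The sigma-algebra of R^n is generated by the coordinates, so openness is
    turned into measurability by writing an open set as the union of the
    sup-norm balls with rational centre and radius 1/(k+1) that it contains. *)
Lemma open_measurable_rV (U : set 'rV[R]_n) : open U -> measurable U.
Proof.
move=> oU.
pose r (p : 'rV[rat]_n * nat) : set 'rV[R]_n :=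
  ball (map_mx (@ratr R) p.1) p.2.+1%:R^-1.
rewrite (_ : U = \bigcup_(p in [set p | r p `<=` U]) r p).
  rewrite bigcup_mkcond; apply: countable_bigcupT_measurable => [|p]; first exact: countableP.
  by case: ifPn => // _; apply: measurable_ball_rV; rewrite invr_gt0.
apply/seteqP; split => [x Ux|x [p /= rU rx]]; last exact: rU.
have /nbhs_ballP[e /= e0 xeU] := open_nbhs_nbhs (conj oU Ux).
have [k ke] : exists k : nat, k.+1%:R^-1 < e / 2.
  have := near_infty_natSinv_lt (PosNum (divr_gt0 e0 (ltr0Sn R 1))).
  by case=> N _ /(_ N) /= => h; exists N; exact: h.
have k0 : 0 < k.+1%:R^-1 :> R by rewrite invr_gt0.
have Q i : {q : rat | `|x ord0 i - ratr q| < k.+1%:R^-1}.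
  apply: cid.
  have [|q] := @rat_in_itvoo R (x ord0 i - k.+1%:R^-1) (x ord0 i + k.+1%:R^-1).
    by rewrite ltrBlDr -addrA ltrDl addr_gt0.
  rewrite in_itv/= => /andP[q1 q2]; exists q.
  by rewrite ltr_distlC q1 q2.
exists (\row_i sval (Q i), k) => /=.
  move=> y [_ ry]; apply: xeU; split => // i j.
  have := ry i j; rewrite !mxE (ord1 i) /ball/= => ryj.
  have := svalP (Q j) => xq.
  have -> : x ord0 j - y ord0 j =
    (x ord0 j - ratr (sval (Q j))) + (ratr (sval (Q j)) - y ord0 j) by ring.
  by apply: le_lt_trans (ler_normD _ _) _;
    rewrite [ltRHS]splitr ltrD// (lt_trans _ ke).
split => // i j; rewrite !mxE (ord1 i) /ball/= distrC.
exact: svalP (Q j).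
Qed.

Lemma continuous_measurable_rV (f : 'rV[R]_n -> R) :
  continuous f -> measurable_fun setT f.
Proof.
move=> /continuousP cf; apply: (measurability _ (RGenOpens.measurableE R)).
move=> _ [_ [a [b ->] <-]]; rewrite setTI; apply: open_measurable_rV.
exact/cf/interval_open.
Qed.

Lemma measurable_fun_addr (v : 'rV[R]_n) :
  measurable_fun setT (fun x : 'rV[R]_n => x + v).
Proof.
apply/measurable_fun_rVP => i /=.
rewrite [X in measurable_fun _ X](_ : _ =
    (fun x : 'rV[R]_n => x ord0 i + v ord0 i : R)); last by apply/funext => x /=; rewrite mxE.
by apply: measurable_funD => //; exact: measurable_coord.
Qed.

End measurability.

Lemma le_coord_norm {R : realType} {n : nat} (x : 'rV[R]_n) i : `|x ord0 i| <= `|x|.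
Proof.
have /mapP[j _ ->] : `|x ord0 i| \in [seq `|x k.1 k.2| | k : 'I_1 * 'I_n].
  by apply/mapP; exists (ord0, i) => //=; rewrite mem_enum.
by rewrite [leRHS]/Num.Def.normr /= mx_normrE; apply/bigmax_geP; right => /=; exists j.
Qed.

Section translation.
Context {R : realType}.

Lemma lebesgue_measure_translation (a : R) (A : set (measurableTypeR R)) :
  measurable A -> lebesgue_measure [set x : measurableTypeR R | A (x + a)] =
                  lebesgue_measure A.
Proof.
move=> mA; have ma : measurable_fun setT
    ((fun x => x + a) : measurableTypeR R -> measurableTypeR R).
  exact: measurable_funD.
pose mphi := isMeasurableFun.Build _ _ _ _ _ ma.
pose phi : {mfun measurableTypeR R >-> measurableTypeR R} := HB.pack
  (fun x : measurableTypeR R => x + a : measurableTypeR R) mphi.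
apply/esym; apply: (@lebesgue_measure_unique R (pushforward lebesgue_measure phi)) => //.
move=> _ [[x y] _ <-] /=.
rewrite /pushforward (_ : phi @^-1` _ = `]x - a, y - a]%classic).
  rewrite !lebesgue_measure_itv /= !lte_fin ltrD2r; case: ifPn => // _.
  by rewrite -!EFinB; congr EFin; ring.
by apply/seteqP; split => z /=; rewrite !in_itv/= /phi/= ltrBlDr lerBrDr.
Qed.

Lemma ge0_integral_lebesgue_translation (a : R)
    (f : measurableTypeR R -> \bar R) :
  measurable_fun setT f -> (forall x, 0 <= f x)%E ->
  (\int[lebesgue_measure]_x f (x + a)%R = \int[lebesgue_measure]_x f x)%E.
Proof.
move=> mf f0; have ma : measurable_fun setT
    ((fun x => x + a) : measurableTypeR R -> measurableTypeR R).
  exact: measurable_funD.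
transitivity (\int[pushforward lebesgue_measure
    (fun x : measurableTypeR R => (x + a)%R : measurableTypeR R)]_x f x)%E.
  by rewrite (ge0_integral_pushforward ma).
apply: eq_measure_integral => A mA _.
exact: lebesgue_measure_translation.
Qed.

Lemma rV_consD n (a b : R) (x y : 'rV[R]_n) :
  rV_cons (a, x) + rV_cons (b, y) = rV_cons (a + b, x + y).
Proof. by rewrite /rV_cons /= raddfD; exact: (@add_row_mx R 1 1 n). Qed.

Lemma rV_consE n (v : 'rV[R]_n.+1) : exists a x, v = rV_cons (a, x).
Proof.
exists (v ord0 ord0), (rsubmx (v : 'rV_(1 + n))).
apply/rowP => i; rewrite /rV_cons /=.
have [j ->|j ->] := @split_ordP 1 n i.
  apply/esym; apply: etrans (row_mxEl _ _ _ _) _.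
  rewrite mxE (ord1 j) eqxx mulr1n; congr (v _ _); exact: val_inj.
by apply/esym; apply: etrans (row_mxEr _ _ _ _) _; rewrite mxE.
Qed.

(** The measure is an iterated product: translating by (a, w) shifts the
    sections by w, which the lower dimension absorbs, and the base by a. *)
Lemma lebesgue_rV_translation n (v : 'rV[R]_n) (A : set 'rV[R]_n) :
  measurable A -> lebesgue_rV n [set x | A (x + v)] = lebesgue_rV n A.
Proof.
elim: n v A => [|n IH] v A mA.
  rewrite /=; congr (\d_ _ _)%E; apply/seteqP; split => x /=;
    by rewrite (_ : x + v = x)//; apply/rowP => -[].
have [a [w ->]] := rV_consE v.
rewrite /= /pushforward /product_measure1.
set A' := rV_cons (n:=n) @^-1` A.
have mA' : measurable A'.
  by rewrite -[X in measurable X]setTI; exact: measurable_rV_cons.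
rewrite -[RHS](ge0_integral_lebesgue_translation a)//; last first.
  exact: measurable_fun_xsection.
apply: eq_integral => x _ /=.
rewrite -[RHS](IH w)//; last exact: measurable_xsection.
congr (lebesgue_rV n _); apply/seteqP; split => y; rewrite /xsection/= !inE /A'/=.
  by rewrite rV_consD.
by rewrite rV_consD.
Qed.

Lemma ge0_integral_rV_translation n (v : 'rV[R]_n) (f : 'rV[R]_n -> \bar R) :
  measurable_fun setT f -> (forall x, 0 <= f x)%E ->
  (\int[lebesgue_rV n]_x f (x + v)%R = \int[lebesgue_rV n]_x f x)%E.
Proof.
move=> mf f0.
transitivity (\int[pushforward (lebesgue_rV n) (fun x => x + v)%R]_x f x)%E.
  by rewrite (ge0_integral_pushforward (measurable_fun_addr v)).
have mv := measurable_fun_addr v.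
apply: eq_measure_integral => A mA _.
exact: lebesgue_rV_translation.
Qed.

End translation.

Section bounded_support.
Context {R : realType} {n : nat}.

Lemma lebesgue_rV_cube (x : 'rV[R]_n) (s : R) : 0 <= s ->
  lebesgue_rV n [set y | forall i, y ord0 i \in `[x ord0 i - s, x ord0 i + s]] =
  ((2 * s) ^+ n)%:E.
Proof.
move=> s0; rewrite (lebesgue_rV_box (A := fun i =>
  [set` `[x ord0 i - s, x ord0 i + s]])) => [|i]; last exact: measurable_itv.
rewrite (eq_bigr (fun=> (2 * s)%:E)) => [|i _].
  by rewrite prodEFin prodr_const card_ord.
rewrite lebesgue_measure_itv /= lte_fin; case: ifPn => [_|].
  by rewrite -EFinB; congr EFin; ring.
by rewrite -leNgt => h; congr EFin; apply/eqP; rewrite eq_le; apply/andP; split; lra.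
Qed.

Lemma measurable_cube (x : 'rV[R]_n) (s : R) :
  measurable [set y : 'rV[R]_n | forall i, y ord0 i \in `[x ord0 i - s, x ord0 i + s]].
Proof.
rewrite (_ : mkset _ = \bigcap_(i in [set: 'I_n])
    ((fun y : 'rV[R]_n => y ord0 i : R) @^-1` [set` `[x ord0 i - s, x ord0 i + s]])).
  apply: fin_bigcap_measurable => // i _.
  by rewrite -[X in measurable X]setTI; apply: measurable_coord => //;
    exact: measurable_itv.
by apply/seteqP; split => y /= h i; [move=> _|]; exact: h.
Qed.

(** With the convention 1/0 = 0 the inverse is the pointwise limit of the
    continuous functions x / (x^2 + 1/(k+1)), including at 0. *)
Lemma measurable_invr : measurable_fun setT (fun x : R => x^-1).
Proof.
apply: (@measurable_fun_cvg _ _ _ _ (fun k (x : R) => x / (x ^+ 2 + k.+1%:R^-1))).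
  move=> k; apply: continuous_measurable_fun => x.
  apply: cvgM; first exact: cvg_id.
  apply: cvgV; first by rewrite gt_eqF// ltr_wpDl ?sqr_ge0 ?invr_gt0.
  by apply: cvgD; [exact: exprn_continuous|exact: cvg_cst].
move=> x _; have [->|x0] := eqVneq x 0.
  by under eq_fun do rewrite mul0r; rewrite invr0; exact: cvg_cst.
have -> : x^-1 = x / (x ^+ 2 + 0) by rewrite addr0 expr2 invfM mulVKf.
apply: cvgM; first exact: cvg_cst.
apply: cvgV; first by rewrite addr0 sqrf_eq0.
by apply: cvgD; [exact: cvg_cst|exact: cvg_harmonic].
Qed.

Lemma integrable_bounded_support (f : 'rV[R]_n -> R) (M r : R) :
  measurable_fun setT f -> (forall x, `|f x| <= M) ->
  (forall x, f x != 0 -> `|x| <= r) ->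
  (lebesgue_rV n).-integrable setT (EFin \o f).
Proof.
move=> mf fM fr.
pose B := [set y : 'rV[R]_n | forall i, y ord0 i \in
  `[(0 : 'rV[R]_n) ord0 i - `|r|, (0 : 'rV[R]_n) ord0 i + `|r|]].
have mB : measurable B by exact: measurable_cube.
have fB : EFin \o f = (EFin \o f) \_ B.
  apply/funext => x; rewrite patchE; case: ifPn => //; rewrite notin_setE => xB.
  congr EFin; apply/eqP; apply: contra_notT xB => /fr xr i /=.
  rewrite mxE in_itv/= sub0r add0r -ler_norml.
  apply: le_trans (le_coord_norm _ _) (le_trans xr (ler_norm _)).
rewrite fB; apply/(integrable_mkcond _ mB).
apply: measurable_bounded_integrable => //.
- by rewrite [X in (X < _)%E](lebesgue_rV_cube 0 (normr_ge0 r)) ltry.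
- exact: measurable_funTS.
- exists M; split; first exact: num_real.
  by move=> N MN x _ /=; apply: le_trans (fM x) (ltW MN).
Qed.

End bounded_support.

(** * The scalar product and derivatives along lines *)

Section dot_product.
Context {R : realType} {n : nat}.
Implicit Types x y z v w : 'rV[R]_n.

Lemma dotC x y : dot x y = dot y x.
Proof. by apply: eq_bigr => i _; rewrite mulrC. Qed.

Lemma dotDl x y z : dot (x + y) z = dot x z + dot y z.
Proof. by rewrite /dot -big_split; apply: eq_bigr => i _; rewrite mxE mulrDl. Qed.

Lemma dotZl (a : R) x y : dot (a *: x) y = a * dot x y.
Proof. by rewrite /dot mulr_sumr; apply: eq_bigr => i _; rewrite mxE mulrA. Qed.

Lemma dotNl x y : dot (- x) y = - dot x y.
Proof. by rewrite -scaleN1r dotZl mulN1r. Qed.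

Lemma dotBl x y z : dot (x - y) z = dot x z - dot y z.
Proof. by rewrite dotDl dotNl. Qed.

Lemma dotDr x y z : dot z (x + y) = dot z x + dot z y.
Proof. by rewrite dotC dotDl !(dotC z). Qed.

Lemma dotZr (a : R) x y : dot y (a *: x) = a * dot y x.
Proof. by rewrite dotC dotZl (dotC y). Qed.

Lemma dotBr x y z : dot z (x - y) = dot z x - dot z y.
Proof. by rewrite dotC dotBl !(dotC z). Qed.

Lemma dot0l x : dot 0 x = 0.
Proof. by rewrite -(scale0r 0) dotZl mul0r. Qed.

Lemma dot_delta (i : 'I_n) x : dot (delta_mx ord0 i) x = x ord0 i.
Proof.
rewrite /dot (bigD1 i)//= mxE !eqxx mul1r big1 ?addr0// => j ji.
by rewrite mxE eqxx (negbTE ji) mul0r.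
Qed.

Lemma dot_ge0 x : 0 <= dot x x.
Proof. by apply: sumr_ge0 => i _; rewrite -expr2 sqr_ge0. Qed.

Lemma dot_gt0 x : x != 0 -> 0 < dot x x.
Proof.
move=> x0; rewrite lt0r dot_ge0 andbT; apply: contra x0 => /eqP/psumr_eq0P h.
apply/eqP/rowP => i; rewrite mxE; apply/eqP; rewrite -sqrf_eq0 expr2.
by apply/eqP/h => // j _; rewrite -expr2 sqr_ge0.
Qed.

Lemma dot_sqrD x y (t : R) :
  dot (x + t *: y) (x + t *: y) = dot x x + 2 * (t * dot x y) + t * (t * dot y y).
Proof. by rewrite dotDl !dotDr !dotZl !dotZr (dotC y x); ring. Qed.

Lemma sqr_enorm x : enorm x ^+ 2 = dot x x.
Proof. exact/sqr_sqrtr/dot_ge0. Qed.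

Lemma enorm_ge0 x : 0 <= enorm x.
Proof. exact: sqrtr_ge0. Qed.

Lemma norm_rV_le x (M : R) : 0 <= M -> (forall i, `|x ord0 i| <= M) -> `|x| <= M.
Proof.
move=> M0 xM; rewrite [leLHS]/Num.Def.normr /= mx_normrE; apply/bigmax_leP; split => //.
by move=> [i j] _ /=; rewrite (ord1 i).
Qed.

Lemma le_coord_enorm x i : `|x ord0 i| <= enorm x.
Proof.
rewrite -sqrtr_sqr ler_sqrt ?dot_ge0// /dot (bigD1 i)//= -expr2 lerDl.
by apply: sumr_ge0 => j _; rewrite -expr2 sqr_ge0.
Qed.

Lemma le_norm_enorm x : `|x| <= enorm x.
Proof. by apply: norm_rV_le => [|i]; [exact: enorm_ge0|exact: le_coord_enorm]. Qed.

Lemma enorm_gt0 x : x != 0 -> 0 < enorm x.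
Proof. by move=> /dot_gt0; rewrite sqrtr_gt0. Qed.

Lemma le_dot x y : dot x y <= enorm x * (n%:R * `|y|).
Proof.
rewrite mulrCA mulr_natl.
apply: (@le_trans _ _ (\sum_(i < n) enorm x * `|y|)).
  apply: ler_sum => i _; apply: le_trans (ler_norm _) _.
  by rewrite normrM ler_pM// ?le_coord_enorm ?le_coord_norm.
by rewrite sumr_const card_ord.
Qed.

Lemma continuous_sumr (F : 'I_n -> 'rV[R]_n -> R) :
  (forall i, continuous (F i)) -> continuous (fun t => \sum_(i < n) F i t).
Proof.
move=> cF.
have -> : (fun t => \sum_(i < n) F i t) = \sum_(i < n) F i.
  by apply/funext => t; rewrite fct_sumE.
elim/big_ind : _ => [|f g cf cg t|i _]; first exact: cst_continuous.
  exact: continuousD (cf t) (cg t).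
exact: cF.
Qed.

Lemma coord_rV_continuous i : continuous (fun x : 'rV[R]_n => x ord0 i).
Proof. exact: (@coord_continuous R 1 n ord0 i). Qed.

Lemma dot_continuous_comp y (f : 'rV[R]_n -> 'rV[R]_n) :
  (forall i, continuous (fun t => f t ord0 i)) -> continuous (fun t => dot y (f t)).
Proof.
move=> cf; apply: continuous_sumr => i t.
by apply: continuousM; [exact: cst_continuous|exact: cf].
Qed.

Lemma dot_continuous y : continuous (dot y).
Proof.
apply: (@dot_continuous_comp y (fun x => x)) => i.
exact: coord_rV_continuous.
Qed.

Lemma enorm_continuous : continuous (@enorm R n).
Proof.
move=> x; apply: continuous_comp; last exact: sqrt_continuous.
move: x; apply: continuous_sumr => i t.
by apply: continuousM; exact: coord_rV_continuous.
Qed.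

End dot_product.

Section line_derivative.
Context {R : realType} {V : normedModType R}.
Implicit Types (f : V -> R) (x v : V).

Lemma norm_lipschitz_continuous f (B : R) :
  (forall x y, `|f x - f y| <= B * `|x - y|) -> continuous f.
Proof.
move=> fB x; apply/cvgrPdist_lt => e e0.
have B0 : 0 < `|B| + 1 by rewrite ltr_wpDl.
near=> y.
apply: le_lt_trans (fB _ _) _.
apply: (@le_lt_trans _ _ ((`|B| + 1) * `|x - y|)).
  by rewrite ler_wpM2r// ler_wpDr// ler_norm.
rewrite mulrC -ltr_pdivlMr//; near: y.
by apply: cvgr_dist_lt => //; rewrite divr_gt0.
Unshelve. all: by end_near. Qed.

(** Epsilon-delta form of directional differentiability, in which increments
    along sums of directions can be added up. *)
Lemma is_deriveP f x v (d : R) : is_derive x v f d <->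
  forall e : R, 0 < e -> exists2 r : R, 0 < r & forall h : R, `|h| < r ->
    `|f (h *: v + x) - f x - h * d| <= e * `|h|.
Proof.
split=> [[df fd] e e0|H].
  move: df; rewrite /derivable => /cvg_ex[l fl].
  have {fd}ld : l = d by rewrite -fd; apply/esym/cvg_lim.
  move/cvgrPdist_le : fl => /(_ e e0); rewrite near_withinE.
  move=> /nbhs_ballP[r /= r0 rP]; exists r => // h hr.
  have [->|h0] := eqVneq h 0.
    by rewrite scale0r add0r subrr mul0r subr0 normr0 mulr0.
  have := rP h; rewrite /ball/= sub0r normrN => /(_ hr h0).
  rewrite ld -[_ *: _]/(_ * _) distrC => hl.
  rewrite (_ : f _ - _ - _ = (h^-1 * (f (h *: v + x) - f x) - d) * h).
    by rewrite normrM ler_wpM2r.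
  by field.
have cl : (fun h => h^-1 *: (f (h *: v + x) - f x)) @ 0^' --> d.
  apply/cvgrPdist_le => e e0; have [r r0 rP] := H _ e0.
  rewrite near_withinE; apply/nbhs_ballP; exists r => //= h.
  rewrite /ball/= sub0r normrN => hr h0.
  rewrite -[_ *: _]/(_ * _) distrC.
  rewrite (_ : _ - _ = (f (h *: v + x) - f x - h * d) / h); last by field.
  by rewrite normrM normfV ler_pdivrMr ?normr_gt0// rP.
by apply: DeriveDef; [apply/cvg_ex; exists d|exact/cvg_lim].
Qed.

End line_derivative.

Section line_derivative_theory.
Context {R : realType} {V : normedModType R}.
Implicit Types (f : V -> R) (x v : V).

Lemma is_derive_line f x v (d : R) (t : R) :
  is_derive (t *: v + x) v f d -> is_derive t 1 (fun s => f (s *: v + x)) d.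
Proof.
move=> /is_deriveP H; apply/is_deriveP => e /H[r r0 rP]; exists r => // h /rP.
by rewrite scalerDl -[h%:A]/(h * 1) mulr1 addrA.
Qed.

Lemma is_derive_scale f x v (d k : R) :
  is_derive x v f d -> is_derive x (k *: v) f (k * d).
Proof.
move=> /is_deriveP H; apply/is_deriveP => e e0.
have k0 : 0 < `|k| + 1 by rewrite ltr_wpDl.
have [r r0 rP] := H _ (divr_gt0 e0 k0).
exists (r / (`|k| + 1)); first by rewrite divr_gt0.
move=> h; rewrite ltr_pdivlMr// => hr.
have hk : `|h * k| <= `|h| * (`|k| + 1) by rewrite normrM ler_wpM2l// lerDl.
have := rP (h * k) (le_lt_trans hk hr); rewrite scalerA mulrA => /le_trans; apply.
apply: le_trans (ler_wpM2l _ hk) _; first by rewrite divr_ge0// ltW.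
by rewrite mulrCA mulrC divfK// gt_eqF.
Qed.

End line_derivative_theory.

(** A right-sided minimum principle: the difference quotient of f at 0 is
    bounded below by c on the positive side. *)
Lemma is_derive_ge {R : realType} (f : R -> R) (d c : R) :
  is_derive (0 : R) 1 f d -> (forall t : R, 0 < t -> f 0 + c * t <= f t) -> c <= d.
Proof.
move=> /is_deriveP H fc; apply/ler_addgt0Pr => e /H[r r0 rP].
have t0 : 0 < r / 2 by rewrite divr_gt0.
have tr : `|r / 2| < r by rewrite gtr0_norm// ltr_pdivrMr// ltr_pMr// ltr1n.
have := rP _ tr; have := fc _ t0.
rewrite addr0 -[_ *: 1]/(_ * 1) mulr1 (gtr0_norm t0) ler_norml => f1 /andP[_ f2].
rewrite -(ler_pM2r t0) mulrDl.
by lra.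
Qed.

Lemma MVT_R {R : realType} (f df : R -> R) (a b : R) :
  (forall x : R, is_derive x 1 f (df x)) ->
  exists2 c, `|c - a| <= `|b - a| & f b - f a = df c * (b - a).
Proof.
move=> fdf.
have cf (x y : R) : {within `[x, y], continuous f}.
  apply: continuous_subspaceT => z; apply: differentiable_continuous.
  by apply/derivable1_diffP; case: (fdf z).
have [ab|/ltW ba] := leP a b.
  have [c + cE] := MVT_segment ab (fun x _ => fdf x) (cf a b).
  rewrite in_itv/= => /andP[ac cb]; exists c => //.
  by rewrite !ger0_norm ?subr_ge0// lerD2r.
have [c + cE] := MVT_segment ba (fun x _ => fdf x) (cf b a).
rewrite in_itv/= => /andP[bc ca]; exists c => //.
  by rewrite !ler0_norm ?subr_le0// lerN2 lerD2r.
by rewrite -opprB cE -mulrN opprB.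
Qed.

(** * Functions of class C^1 and anisotropic norms *)

Section C1_functions.
Context {R : realType} {n : nat}.
Implicit Types (x v w : 'rV[R]_n) (phi : 'rV[R]_n -> R).

(** The increment along w + c e_i splits into an increment along w and one along
    e_i based at the moving point x + h w; the mean value theorem and the
    continuity of the i-th partial derivative control the latter. *)
Let is_derive_add_coord phi (i : 'I_n) x w (c d : R) :
  (forall y, derivable phi y (delta_mx ord0 i)) -> continuous (partial i phi) ->
  is_derive x w phi d ->
  is_derive x (w + c *: delta_mx ord0 i) phi (d + c * partial i phi x).
Proof.
move=> dphi cphi /is_deriveP H; apply/is_deriveP => e e0.
have [r1 r10 r1P] := H _ (divr_gt0 e0 (ltr0Sn R 1)).
have c0 : 0 < `|c| + 1 by rewrite ltr_wpDl.
have e20 : 0 < e / 2 / (`|c| + 1) by rewrite !divr_gt0.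
have /cvgrPdist_le/(_ _ e20)/nbhs_ballP[r2 /= r20 r2P] := cphi x.
set E := delta_mx ord0 i.
have K0 : 0 < `|w| + `|c| * `|E| + 1.
  by rewrite ltr_wpDl// addr_ge0// mulr_ge0.
exists (Num.min r1 (r2 / (`|w| + `|c| * `|E| + 1))).
  by rewrite lt_min r10 divr_gt0.
move=> h; rewrite lt_min => /andP[hr1]; rewrite ltr_pdivlMr// => hr2.
have [s sh sE] := @MVT_R R (fun t => phi (t *: E + (h *: w + x)))
  (fun t => partial i phi (t *: E + (h *: w + x))) 0 (h * c)
  (fun t => is_derive_line (derivableP (dphi _))).
rewrite !subr0 scale0r add0r in sh sE.
rewrite (_ : h *: (w + c *: E) + x = (h * c) *: E + (h *: w + x)); last first.
  by rewrite scalerDr scalerA addrAC addrC.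
rewrite (_ : _ - _ - _ = (phi (h *: w + x) - phi x - h * d) +
  (partial i phi (s *: E + (h *: w + x)) - partial i phi x) * (h * c)); last first.
  by rewrite mulrBl -sE; ring.
apply: le_trans (ler_normD _ _) _.
rewrite [leRHS](_ : _ = e / 2 * `|h| + e / 2 * `|h|); last first.
  by rewrite -mulrDl -splitr.
rewrite lerD ?r1P//.
rewrite normrM distrC.
have : `|partial i phi x - partial i phi (s *: E + (h *: w + x))| <=
       e / 2 / (`|c| + 1).
  apply: r2P; rewrite -ball_normE /ball_/=.
  rewrite addrA opprD addrCA addrN addr0 normrN.
  apply: le_lt_trans hr2.
  apply: le_trans (ler_normD _ _) _; rewrite !normrZ.
  apply: (@le_trans _ _ (`|h * c| * `|E| + `|h| * `|w|)).
    by rewrite lerD2r ler_wpM2r.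
  rewrite normrM !mulrDr mulr1 addrC -mulrA lerDl//.
move=> /(ler_wpM2r (normr_ge0 (h * c)))/le_trans; apply.
rewrite normrM -[leLHS]mulrA ler_wpM2l ?divr_ge0 ?(ltW e0)//.
rewrite mulrCA ler_piMr// mulrC ler_pdivrMr// mul1r.
by rewrite lerDl.
Qed.

(** The direction v is reached by adding its coordinates one at a time. *)
Lemma C1_is_derive phi :
  (forall i y, derivable phi y (delta_mx ord0 i)) ->
  (forall i, continuous (partial i phi)) ->
  forall x v, is_derive x v phi (dot v (grad phi x)).
Proof.
move=> dphi cphi x v.
pose tr k : 'rV[R]_n := \row_i (if (i < k)%N then v ord0 i else 0).
suff H k : (k <= n)%N -> is_derive x (tr k) phi (dot (tr k) (grad phi x)).
  have <- : tr n = v by apply/rowP => i; rewrite mxE ltn_ord.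
  exact: H.
elim: k => [_|k IH kn].
  have -> : tr 0%N = 0 by apply/rowP => i; rewrite !mxE.
  rewrite dot0l; exact: is_derive0.
pose i := Ordinal kn.
have -> : tr k.+1 = tr k + v ord0 i *: delta_mx ord0 i.
  apply/rowP => j; rewrite !mxE eqxx /= ltnS.
  have [->|ji] := eqVneq j i; first by rewrite leqnn ltnn mulr1 add0r.
  rewrite mulr0 addr0; suff -> : (j <= k)%N = (j < k)%N by [].
  rewrite leq_eqVlt; case: eqP => // jk; exfalso.
  by move/eqP: ji; apply; exact: val_inj.
rewrite dotDl dotZl dot_delta [grad _ _ _ _]mxE.
by apply: is_derive_add_coord => //; exact: IH (ltnW kn).
Qed.

End C1_functions.

Section anisotropic_norm_theory.
Context {R : realType} {n : nat} (alpha1 : R) (F : 'rV[R]_n -> R).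
Hypothesis alpha1_gt0 : 0 < alpha1.
Hypothesis FP : anisotropic_norm alpha1 F.
Implicit Types x y v xi nu : 'rV[R]_n.

Lemma aniso_ge0 x : 0 <= F x. Proof. exact: (anisotropic_ge0 FP). Qed.

Lemma anisoZ (t : R) x : F (t *: x) = `|t| * F x.
Proof. exact: (anisotropic_homogeneous FP). Qed.

Lemma aniso0 : F 0 = 0.
Proof. by rewrite -(scale0r (0 : 'rV[R]_n)) anisoZ normr0 mul0r. Qed.

Lemma anisoN x : F (- x) = F x.
Proof. by rewrite -scaleN1r anisoZ normrN1 mul1r. Qed.

Lemma aniso_gt0 x : x != 0 -> 0 < F x.
Proof.
move=> /enorm_gt0 x0; apply: lt_le_trans (anisotropic_coercive FP x).
exact: mulr_gt0.
Qed.

Lemma anisoD x y : F (x + y) <= F x + F y.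
Proof.
have h0 : 0 <= (2^-1 : R) by rewrite invr_ge0.
have h1 : (2^-1 : R) <= 1 by rewrite invf_le1// ler1n.
have := @anisotropic_convex _ _ _ _ FP (Itv01 h0 h1) (2 *: x) (2 *: y)
  (mem_set I) (mem_set I).
rewrite convRE /= /unstable.onem (_ : 1 - 2^-1 = 2^-1 :> R); last lra.
have E z : 2^-1 *: (2 *: z) = z :> 'rV[R]_n by rewrite scalerA mulVf// scale1r.
rewrite /conv /= /unstable.onem (_ : 1 - 2^-1 = 2^-1 :> R); last lra.
by rewrite !E !anisoZ ger0_norm// !mulKf.
Qed.

Lemma aniso_sum (I : Type) (r : seq I) (P : pred I) (f : I -> 'rV[R]_n) :
  F (\sum_(i <- r | P i) f i) <= \sum_(i <- r | P i) F (f i).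
Proof.
elim/big_ind2 : _ => // [|a b c d ac bd]; first by rewrite aniso0.
by apply: le_trans (anisoD _ _) _; rewrite lerD.
Qed.

Definition aniso_bound : R := \sum_(i < n) F (delta_mx ord0 i).

Lemma aniso_bound_ge0 : 0 <= aniso_bound.
Proof. by apply: sumr_ge0 => i _; exact: aniso_ge0. Qed.

Lemma aniso_le_norm x : F x <= aniso_bound * `|x|.
Proof.
rewrite [in leLHS](row_sum_delta x) mulr_suml.
apply: le_trans (aniso_sum _ _ _) _; apply: ler_sum => i _.
by rewrite anisoZ mulrC ler_wpM2l ?aniso_ge0// le_coord_norm.
Qed.

Lemma aniso_continuous : continuous F.
Proof.
apply: (@norm_lipschitz_continuous R _ F aniso_bound) => x y.
have H a b : F a - F b <= aniso_bound * `|a - b|.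
  apply: le_trans (aniso_le_norm _); rewrite lerBlDr.
  by rewrite -{1}(subrK b a) anisoD.
by rewrite ler_norml H andbT lerNl opprB distrC H.
Qed.

(** The partial derivatives alone determine the one-sided behaviour of the
    convex function F along v: nu - t v is the average over i of the points
    nu - n t v_i e_i, so F(nu - t v) is at most the average of the
    corresponding values, whose derivative at t = 0 is - v . grad F(nu). *)
Lemma grad_aniso_le nu v (c : R) : nu != 0 ->
  (forall t : R, 0 < t -> F nu - c * t <= F (nu - t *: v)) ->
  dot v (grad F nu) <= c.
Proof.
move=> nu0 H; have n0 : (n%:R != 0 :> R).
  rewrite pnatr_eq0; apply: contra nu0 => /eqP n0.
  by apply/eqP/rowP => i; exfalso; move: i; rewrite n0 => -[].
pose w i : 'rV[R]_n := (- (n%:R * v ord0 i)) *: delta_mx ord0 i.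
pose h i (t : R) : R := F (t *: w i + nu).
have dh i : is_derive (0 : R) 1 (h i) (- (n%:R * v ord0 i) * partial i F nu).
  apply: is_derive_line; rewrite scale0r add0r; apply: is_derive_scale.
  by apply: derivableP; have [_ /(_ i)[dF _]] := anisotropic_C2 FP; exact: dF.
have dG := is_deriveZ (n%:R^-1) (is_derive_sum dh).
rewrite -lerN2.
have {dG} := is_derive_ge dG; rewrite fct_sumE.
have -> : n%:R^-1 *: \sum_(i < n) - (n%:R * v ord0 i) * partial i F nu =
    - dot v (grad F nu).
  rewrite /dot -sumrN scaler_sumr; apply: eq_bigr => i _.
  by rewrite mxE -[_ *: _]/(_ * _) mulNr mulrN -mulrA mulKf.
apply => t t0.
change (n%:R^-1 * (\sum_i h i 0) + - c * t <= n%:R^-1 * (\sum_i h i t)).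
rewrite (eq_bigr (fun=> F nu)); last first.
  by move=> i _; rewrite /h scale0r add0r.
rewrite sumr_const card_ord -[F nu *+ n]mulr_natl mulKf// mulNr.
apply: le_trans (H _ t0) _.
have -> : nu - t *: v = \sum_(i < n) n%:R^-1 *: (t *: w i + nu).
  rewrite -scaler_sumr big_split /= sumr_const card_ord -scaler_sumr.
  rewrite -[nu *+ n]scaler_nat scalerDr [X in _ = _ + X]scalerA mulVf//.
  rewrite scale1r addrC; congr (_ + _).
  rewrite scalerA mulrC -scalerA -scalerN; congr (_ *: _).
  rewrite scaler_sumr [in LHS](row_sum_delta v) -sumrN; apply: eq_bigr => i _.
  by rewrite /w scalerA mulrN mulKf// scaleNr.
apply: le_trans (aniso_sum _ _ _) _; rewrite mulr_sumr.
apply: ler_sum => i _; rewrite anisoZ ger0_norm ?invr_ge0//.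
Qed.

(** The gradient of F at nu is a subgradient, and lies in the unit ball of the
    polar norm. *)
Lemma dot_grad_aniso_le nu xi : nu != 0 -> dot xi (grad F nu) <= F xi.
Proof.
move=> nu0; apply: grad_aniso_le => // t t0.
rewrite lerBlDr -{1}(subrK (t *: xi) nu); apply: le_trans (anisoD _ _) _.
by rewrite lerD2l anisoZ (gtr0_norm t0) mulrC.
Qed.

(** Euler's identity for the 1-homogeneous function F. *)
Lemma dot_grad_aniso nu : nu != 0 -> dot nu (grad F nu) = F nu.
Proof.
move=> nu0; apply/eqP; rewrite eq_le dot_grad_aniso_le//= -lerN2 -dotNl.
apply: grad_aniso_le => // t t0.
rewrite scalerN opprK mulNr opprK -[X in X + t *: _]scale1r -scalerDl anisoZ.
by rewrite ger0_norm ?addr_ge0// ?(ltW t0)// mulrDl mul1r mulrC.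
Qed.

Lemma abs_dot_grad_aniso_le nu xi : nu != 0 -> `|dot xi (grad F nu)| <= F xi.
Proof.
move=> nu0; rewrite ler_norml dot_grad_aniso_le// andbT lerNl -dotNl.
by apply: le_trans (dot_grad_aniso_le _ nu0) _; rewrite anisoN.
Qed.

Hypothesis n_gt0 : (0 < n)%N.

Let polar_set x := [set dot xi x / F xi | xi in [set xi | xi != 0]].

Let polar_set_ub x : ubound (polar_set x) (n%:R * `|x| / alpha1).
Proof.
move=> _ [xi /= xi0 <-]; rewrite ler_pdivrMr ?aniso_gt0// mulrAC ler_pdivlMr//.
apply: le_trans (ler_wpM2r (ltW alpha1_gt0) (le_dot xi x)) _.
rewrite [enorm xi * _]mulrC.
rewrite -mulrA ler_wpM2l ?mulr_ge0// mulrC.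
exact: anisotropic_coercive FP xi.
Qed.

Lemma dot_le_polar xi x : dot xi x <= F xi * polar F x.
Proof.
have [->|xi0] := eqVneq xi 0; first by rewrite dot0l aniso0 mul0r.
rewrite -ler_pdivrMl ?aniso_gt0// mulrC.
by apply: sup_ubound; [exists (n%:R * `|x| / alpha1); exact: polar_set_ub|exists xi].
Qed.

Let polar_set_nonempty x : polar_set x !=set0.
Proof.
pose i := Ordinal n_gt0.
exists (dot (delta_mx ord0 i) x / F (delta_mx ord0 i)), (delta_mx ord0 i) => //=.
apply/eqP => /rowP/(_ i)/eqP; rewrite !mxE !eqxx/= oner_eq0 //.
Qed.

Lemma polar_le x (M : R) : (forall xi, dot xi x <= F xi * M) -> polar F x <= M.
Proof.
move=> H; apply: ge_sup; first exact: polar_set_nonempty.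
by move=> _ [xi /= xi0 <-]; rewrite ler_pdivrMr ?aniso_gt0// mulrC.
Qed.

Lemma polar_le_norm x : polar F x <= n%:R / alpha1 * `|x|.
Proof.
apply: ge_sup; first exact: polar_set_nonempty.
by rewrite mulrAC; exact: polar_set_ub.
Qed.

Lemma polar_ge0 x : 0 <= polar F x.
Proof.
have [->|x0] := eqVneq x 0.
  have [z [xi /= xi0 _]] := polar_set_nonempty 0.
  have := dot_le_polar xi 0; rewrite dotC dot0l pmulr_rge0//; exact: aniso_gt0.
have := dot_le_polar x x; move/(le_trans (dot_ge0 x)).
by rewrite pmulr_rge0// aniso_gt0.
Qed.

Lemma polarD x y : polar F (x + y) <= polar F x + polar F y.
Proof. by apply: polar_le => xi; rewrite dotDr mulrDr lerD// dot_le_polar. Qed.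

Lemma polarZ (k : R) x : 0 <= k -> polar F (k *: x) <= k * polar F x.
Proof.
by move=> k0; apply: polar_le => xi; rewrite dotZr mulrCA ler_wpM2l// dot_le_polar.
Qed.

End anisotropic_norm_theory.

(** * Bounded convex domains *)

Section closure_norm.
Context {R : realType} {n : nat}.
Implicit Types (A : set 'rV[R]_n) (x y : 'rV[R]_n).

Lemma closure_normP A x :
  closure A x <-> forall e : R, 0 < e -> exists2 y, A y & `|x - y| < e.
Proof.
split=> [Ax e e0|H B /nbhs_ballP[e /= e0 eB]].
  have [y [Ay xy]] := Ax _ (nbhsx_ballx x e e0); exists y => //.
  by move: xy; rewrite -ball_normE.
have [y Ay xy] := H _ e0; exists y; split => //.
by apply: eB; rewrite -ball_normE.
Qed.

Lemma open_normP A x : open A -> A x ->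
  exists2 e : R, 0 < e & forall y, `|x - y| < e -> A y.
Proof.
move=> oA Ax; have /nbhs_ballP[e /= e0 eA] := open_nbhs_nbhs (conj oA Ax).
by exists e => // y xy; apply: eA; rewrite -ball_normE.
Qed.

Lemma bounded_setP A : bounded_set A ->
  exists2 M : R, 0 < M & forall x, A x -> `|x| <= M.
Proof.
move=> [M [_ AM]]; exists (`|M| + 1) => [|x Ax]; first by rewrite ltr_wpDl.
by apply: AM => //; rewrite (le_lt_trans (ler_norm M))// ltrDl.
Qed.

Lemma bounded_closure_compact A : bounded_set A -> compact (closure A).
Proof.
move=> /bounded_setP[M M0 AM]; apply: bounded_closed_compact; last exact: closed_closure.
exists M; split => [|N MN x /closure_normP Ax]; first exact: num_real.
have [y Ay xy] := Ax (N - M) ltac:(by rewrite subr_gt0).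
rewrite -(subrK y x); apply: le_trans (ler_normD _ _) _.
by rewrite -(subrK M N) lerD ?AM// ltW.
Qed.

End closure_norm.

Section convex_domain.
Context {R : realType} {n : nat}.
Variable Omega : set 'rV[R]_n.
Hypothesis OP : domain Omega.
Implicit Types x y z : 'rV[R]_n.

Let oO : open Omega. Proof. by case: OP. Qed.

Lemma boundary_notin y : boundary Omega y -> ~ Omega y.
Proof. by move=> [_ H] Oy; apply: H; exact: open_nbhs_nbhs. Qed.

Lemma boundary_closure y : boundary Omega y -> closure Omega y.
Proof. by case. Qed.

Lemma boundaryP y : closure Omega y -> ~ Omega y -> boundary Omega y.
Proof. by move=> cy Oy; split => // /interior_subset. Qed.

Lemma domain_nonempty : Omega !=set0.
Proof.
have [_ _ [y /boundary_closure/closure_normP/(_ 1 ltr01)[z Oz _]]] := OP.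
by exists z.
Qed.

Lemma domain_dim_gt0 : (0 < n)%N.
Proof.
have [_ _ [y yO]] := OP; have [x Ox] := domain_nonempty.
rewrite lt0n; apply/negP => /eqP n0; apply: (boundary_notin yO).
suff -> : y = x by [].
by apply/rowP => i; exfalso; move: i; rewrite n0 => -[].
Qed.

(** The last time at which the segment is in Omega gives the boundary point. *)
Lemma segment_meets_boundary x y : Omega x -> ~ Omega y ->
  exists2 t : R, 0 <= t <= 1 & boundary Omega (x + t *: (y - x)).
Proof.
move=> Ox Oy.
pose T := [set t : R | 0 <= t <= 1 /\ Omega (x + t *: (y - x))].
have T0 : T 0 by split; rewrite ?lexx ?ler01// scale0r addr0.
have T1 : ubound T 1 by move=> t [/andP[]].
have supT : has_sup T by split; [exists 0|exists 1].
pose t := sup T.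
have t0 : 0 <= t by apply: sup_ubound => //; exists 1.
have t1 : t <= 1 by apply: ge_sup; [exists 0|].
have K0 : 0 < `|y - x| + 1 by rewrite ltr_wpDl.
exists t; first by rewrite t0.
apply: boundaryP.
  apply/closure_normP => e e0.
  have [s Ts ts] := sup_adherent (divr_gt0 e0 K0) supT.
  exists (x + s *: (y - x)); first by case: Ts.
  have st : s <= t by apply: sup_ubound => //; exists 1.
  rewrite opprD addrACA subrr add0r -scalerBl normrZ ger0_norm ?subr_ge0//.
  apply: (@le_lt_trans _ _ ((t - s) * (`|y - x| + 1))).
    by rewrite ler_wpM2l ?subr_ge0// lerDl.
  by rewrite -ltr_pdivlMr// ltrBlDr -ltrBlDl.
move=> Ot; have [e e0 eO] := open_normP oO Ot.
have tlt1 : t < 1.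
  rewrite lt_neqAle t1 andbT; apply/eqP => tE; apply: Oy; move: Ot.
  by rewrite tE scale1r addrC subrK.
pose s := Num.min 1 (t + e / (2 * (`|y - x| + 1))).
have ts : t < s by rewrite lt_min tlt1 ltrDl divr_gt0// mulr_gt0.
suff : T s by move=> Ts; have := sup_ubound (ex_intro _ 1 T1) Ts; rewrite leNgt ts.
split; first by rewrite (le_trans t0 (ltW ts)) ge_min lexx.
apply: eO; rewrite opprD addrACA subrr add0r -scalerBl normrZ.
rewrite ler0_norm ?subr_le0 ?(ltW ts)// opprB.
apply: (@le_lt_trans _ _ (e / (2 * (`|y - x| + 1)) * (`|y - x| + 1))).
  apply: ler_pM => //; rewrite ?subr_ge0 ?(ltW ts)// ?lerDl//.
  by rewrite lerBlDl ge_min lexx orbT.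
rewrite invfM mulrA divfK ?gt_eqF// ltr_pdivrMr// ltr_pMr// ltr1n//.
Qed.

Hypothesis cO : convex_set Omega.

Lemma convex_setP x y (a b : R) : 0 <= a -> 0 <= b -> a + b = 1 ->
  Omega x -> Omega y -> Omega (a *: x + b *: y).
Proof.
move=> a0 b0 ab Ox Oy; have a1 : a <= 1 by rewrite -ab lerDl.
have := cO (Itv01 a0 a1) (mem_set Ox) (mem_set Oy).
rewrite inE /conv /= /unstable.onem.
by rewrite (_ : 1 - a = b)// -ab addrC addKr.
Qed.

(** If the point beyond y were a limit of points z of Omega, then y would be a
    convex combination of such a z and of a point w close to x, hence in Omega. *)
Lemma beyond_boundary x y (s : R) : Omega x -> boundary Omega y -> 0 < s ->
  ~ closure Omega (y + s *: (y - x)).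
Proof.
move=> Ox yO s0 /closure_normP cy; apply: (boundary_notin yO).
have [r r0 rO] := open_normP oO Ox.
have [z Oz yz] := cy (r * s) (mulr_gt0 r0 s0).
have s10 : 0 < 1 + s by rewrite addr_gt0.
pose w := x + s^-1 *: (y + s *: (y - x) - z).
have Ow : Omega w.
  apply: rO; rewrite opprD addrA subrr add0r normrN normrZ gtr0_norm ?invr_gt0//.
  by rewrite mulrC ltr_pdivrMr.
have := @convex_setP w z (s / (1 + s)) (1 + s)^-1 _ _ _ Ow Oz.
rewrite (_ : _ *: w + _ = y).
  apply; rewrite ?divr_ge0 ?invr_ge0 ?(ltW s0) ?(ltW s10)//.
  by rewrite addrC -[X in X + _]mul1r -mulrDl mulfV// gt_eqF.
apply/rowP => i; rewrite !mxE; field.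
by rewrite !gt_eqF.
Qed.

Hypothesis bO : bounded_set Omega.

(** The normal vector points from y to its Euclidean projection p on the closure
    of Omega; minimality of p along the segments towards Omega gives the
    inequality. *)
Lemma separation y : ~ closure Omega y ->
  exists2 nu : 'rV[R]_n, nu != 0 & forall z, Omega z -> dot nu nu <= dot nu (z - y).
Proof.
move=> yO.
have cf : {within closure Omega, continuous (fun z => enorm (z - y))}.
  apply: continuous_subspaceT => z.
  apply: (@continuous_comp _ _ _ (fun z => z - y) (@enorm R n)).
    by apply: (@continuousB _ _ _ id (cst y)); [exact: cvg_id|exact: cst_continuous].
  exact: enorm_continuous.
have [z0 /subset_closure cz0] := domain_nonempty.
have [p /[!inE] pO pmin] := EVT_min_rV (ex_intro _ z0 cz0)
  (bounded_closure_compact bO) cf.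
exists (p - y).
  by apply/eqP => /subr0_eq py; apply: yO; rewrite -py.
move=> z Oz; set a := p - y; pose b := z - p.
have -> : z - y = b + a by rewrite /a /b addrA subrK.
rewrite dotDr lerDr leNgt; apply/negP => ab0.
have bb1 : 0 < dot b b + 1 by rewrite ltr_wpDl// dot_ge0.
pose t := Num.min 1 (- dot a b / (dot b b + 1)).
have t0 : 0 < t by rewrite lt_min ltr01 divr_gt0// oppr_gt0.
have t1 : t <= 1 by rewrite ge_min lexx.
have pt : closure Omega (p + t *: b).
  apply/closure_normP => e e0; have /closure_normP/(_ _ e0)[q Oq pq] := pO.
  exists ((1 - t) *: q + t *: z).
    by apply: convex_setP => //; rewrite ?subr_ge0 ?(ltW t0)// subrK.
  have -> : p + t *: b - ((1 - t) *: q + t *: z) = (1 - t) *: (p - q).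
    by apply/rowP => i; rewrite !mxE; ring.
  rewrite normrZ ger0_norm ?subr_ge0//; apply: le_lt_trans pq.
  by rewrite ler_piMl// gerBl ltW.
have := pmin _ (mem_set pt).
rewrite ler_sqrt ?dot_ge0// (_ : p + _ - y = a + t *: b); last by rewrite addrAC.
rewrite -/a dot_sqrD.
have tb : t * dot b b <= - dot a b.
  apply: (@le_trans _ _ (- dot a b / (dot b b + 1) * (dot b b + 1))); last first.
    by rewrite divfK// gt_eqF.
  apply: ler_pM; rewrite ?dot_ge0 ?(ltW t0)// ?lerDl//.
  by rewrite ge_min lexx orbT.
have : t * (t * dot b b) <= t * - dot a b by rewrite ler_wpM2l// ltW.
have : t * dot a b < 0 by rewrite pmulr_rlt0.
rewrite mulrN; move: (t * dot a b) (t * (t * dot b b)) (dot a a) => u v w.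
by lra.
Qed.

End convex_domain.

(** * The anisotropic distance to the boundary *)

Section anisotropic_distance.
Context {R : realType} {n : nat} (alpha1 : R) (F : 'rV[R]_n -> R).
Variable Omega : set 'rV[R]_n.
Hypothesis alpha1_gt0 : 0 < alpha1.
Hypothesis FP : anisotropic_norm alpha1 F.
Hypothesis OP : domain Omega.
Implicit Types x y z : 'rV[R]_n.

Let n_gt0 : (0 < n)%N := domain_dim_gt0 OP.
Local Notation d := (anisotropic_dist F Omega).

Let dset x := [set polar F (x - y) | y in boundary Omega].

Let dset_has_inf x : has_inf (dset x).
Proof.
split; first by have [_ _ [y yO]] := OP; exists (polar F (x - y)), y.
by exists 0 => _ [y _ <-]; exact: polar_ge0 alpha1_gt0 FP n_gt0 _.
Qed.

Lemma aniso_dist_le x y : boundary Omega y -> d x <= polar F (x - y).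
Proof. by move=> yO; apply: ge_inf; [case: (dset_has_inf x)|exists y]. Qed.

Lemma aniso_dist_ge x (M : R) :
  (forall y, boundary Omega y -> M <= polar F (x - y)) -> M <= d x.
Proof.
move=> H; apply: lb_le_inf; first by case: (dset_has_inf x).
by move=> _ [y yO <-]; exact: H.
Qed.

Lemma aniso_dist_ge0 x : 0 <= d x.
Proof. by apply: aniso_dist_ge => y _; exact: polar_ge0 alpha1_gt0 FP n_gt0 _. Qed.

Lemma aniso_dist_approx x (e : R) : 0 < e ->
  exists2 y, boundary Omega y & polar F (x - y) < d x + e.
Proof.
by move=> e0; have [_ [y yO <-] ye] := inf_adherent e0 (dset_has_inf x); exists y.
Qed.

Lemma aniso_dist_lipschitz x y : `|d x - d y| <= n%:R / alpha1 * `|x - y|.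
Proof.
have H a b : d a - d b <= n%:R / alpha1 * `|a - b|.
  rewrite lerBlDr addrC -lerBlDr; apply: aniso_dist_ge => z zO.
  rewrite lerBlDr; apply: le_trans (aniso_dist_le a zO) _.
  rewrite (_ : a - z = (b - z) + (a - b)); last by rewrite [RHS]addrC subrKA.
  apply: le_trans (polarD alpha1_gt0 FP n_gt0 _ _) _.
  by rewrite lerD2l (polar_le_norm alpha1_gt0 FP n_gt0).
by rewrite ler_norml H andbT lerNl opprB distrC H.
Qed.

Lemma aniso_dist_continuous : continuous d.
Proof.
exact: (@norm_lipschitz_continuous R _ d (n%:R / alpha1)) aniso_dist_lipschitz.
Qed.

Hypothesis cO : convex_set Omega.
Hypothesis bO : bounded_set Omega.

(** These half-spaces compute d as an infimum of normalized affine functions.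
    A nearly optimal boundary point y is pushed slightly outwards before
    separating, which makes the affine function bounded below by a positive
    constant on Omega. *)
Lemma supporting_halfspace x (e : R) : Omega x -> 0 < e ->
  exists (nu : 'rV[R]_n) (c m : R), [/\ F nu = 1, 0 < m,
    forall z, Omega z -> m <= dot nu z - c & dot nu x - c < d x + e].
Proof.
move=> Ox e0; have [y yO xy] := aniso_dist_approx x e0.
pose p := polar F (x - y).
have p0 : 0 <= p by exact: polar_ge0 alpha1_gt0 FP n_gt0 _.
(* s is small enough for (1 + s) p to stay below d x + e. *)
pose s := (d x + e - p) / (2 * (p + 1)).
have p10 : 0 < 2 * (p + 1) by rewrite mulr_gt0// ltr_wpDl.
have s0 : 0 < s by rewrite divr_gt0// subr_gt0.
have sp : (1 + s) * p < d x + e.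
  have : s * p < d x + e - p.
    rewrite /s mulrAC ltr_pdivrMr// ltr_pM2l ?subr_gt0//.
    by move: p0; lra.
  by rewrite mulrDl mul1r; lra.
have [nu nu0 nuP] := separation OP cO bO (beyond_boundary OP cO Ox yO s0).
have Fnu := aniso_gt0 alpha1_gt0 FP nu0.
set y' := y + s *: (y - x) in nuP.
exists ((F nu)^-1 *: nu), (dot ((F nu)^-1 *: nu) y'), (dot nu nu / F nu); split.
- by rewrite (anisoZ FP) ger0_norm ?invr_ge0 ?(ltW Fnu)// mulVf// gt_eqF.
- by rewrite divr_gt0// dot_gt0.
- by move=> z /nuP h; rewrite -dotBr dotZl mulrC ler_wpM2l// invr_ge0 ltW.
rewrite -dotBr; apply: (le_lt_trans _ sp).
have -> : x - y' = (1 + s) *: (x - y).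
  by apply/rowP => i; rewrite !mxE; ring.
apply: le_trans (dot_le_polar alpha1_gt0 FP _ _) _.
rewrite (anisoZ FP) ger0_norm ?invr_ge0 ?(ltW Fnu)// mulVf ?gt_eqF// mul1r.

by apply: (polarZ alpha1_gt0 FP n_gt0); rewrite addr_ge0// ltW.
Qed.

(** The segment from x to a point y outside Omega would contain a boundary point
    z, and the polar norm of x - z is at most n s / alpha1. *)
Lemma ball_sub_domain x (s : R) : Omega x -> n%:R / alpha1 * s < d x ->
  forall y, `|y - x| <= s -> Omega y.
Proof.
move=> Ox sd y yx; apply: contrapT => Oy.
have [t /andP[t0 t1] zO] := segment_meets_boundary OP Ox Oy.
suff : d x < d x by rewrite ltxx.
apply: le_lt_trans (aniso_dist_le x zO) (le_lt_trans _ sd).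
apply: le_trans (polar_le_norm alpha1_gt0 FP n_gt0 _) _.
rewrite ler_wpM2l ?divr_ge0 ?(ltW alpha1_gt0)//.
rewrite opprD addrA subrr add0r normrN normrZ ger0_norm//.
by apply: le_trans yx; rewrite ler_piMl.
Qed.

Let mO : measurable Omega.
Proof. by apply: open_measurable_rV; case: OP. Qed.

Lemma domain_volume_lty : (lebesgue_rV n Omega < +oo)%E.
Proof.
have [M M0 OM] := bounded_setP bO.
apply: (@le_lt_trans _ _ ((2 * M) ^+ n)%:E); last exact: ltry.
rewrite -(lebesgue_rV_cube 0 (ltW M0)).
apply: (@le_measure _ _ _ (lebesgue_rV n)); rewrite ?inE//; first exact: measurable_cube.
move=> y /OM yM i; rewrite /= mxE in_itv/= sub0r add0r -ler_norml.
exact: le_trans (le_coord_norm _ _) yM.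
Qed.

Lemma cube_le_volume x (s : R) : Omega x -> 0 <= s -> n%:R / alpha1 * s < d x ->
  (2 * s) ^+ n <= fine (lebesgue_rV n Omega).
Proof.
move=> Ox s0 sd; rewrite -lee_fin fineK ?ge0_fin_numE ?domain_volume_lty//.
rewrite -(lebesgue_rV_cube x s0).
apply: (@le_measure _ _ _ (lebesgue_rV n)); rewrite ?inE//; first exact: measurable_cube.
move=> y /= H; apply: (ball_sub_domain Ox sd); apply: norm_rV_le => // i.
by rewrite !mxE ler_distl; have := H i; rewrite in_itv.
Qed.

(** A cube centred at x with half-side slightly smaller than alpha1 d(x) / n fits
    in Omega, so its volume is at most that of Omega. *)
Lemma aniso_dist_le_volume x : Omega x ->
  d x <= n%:R / (2 * alpha1) * fine (lebesgue_rV n Omega) `^ (n%:R^-1).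
Proof.
move=> Ox; rewrite leNgt; apply/negP.
set V := fine _; set K := _ * _ => Kd.
have n0 : 0 < n%:R :> R by rewrite ltr0n.
have K0 : 0 <= K by rewrite mulr_ge0 ?powR_ge0// divr_ge0// mulr_ge0// ltW.
pose s := alpha1 / n%:R * ((d x + K) / 2).
have dK0 : 0 < d x + K by rewrite ltr_wpDr// (le_lt_trans K0).
have s0 : 0 < s by rewrite !mulr_gt0// ?invr_gt0.
have := @cube_le_volume x s Ox (ltW s0); rewrite -/V.
have -> : n%:R / alpha1 * s = (d x + K) / 2.
  by rewrite /s; field; rewrite !gt_eqF.
have -> : (d x + K) / 2 < d x by rewrite ltr_pdivrMr// mulr_natr mulr2n ltrD2l.
move=> /(_ isT) sV.
have : ((2 * s) ^+ n) `^ n%:R^-1 <= V `^ n%:R^-1.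
  have V0 : 0 <= V by exact: fine_ge0.
  by apply: ge0_ler_powR; rewrite ?invr_ge0 ?nnegrE// exprn_ge0// mulr_ge0// ltW.
have s20 : 0 <= 2 * s by rewrite mulr_ge0// ltW.
have -> : ((2 * s) ^+ n) `^ n%:R^-1 = 2 * s.
  by rewrite -(powR_mulrn _ s20) -powRrM mulfV ?gt_eqF// powRr1.
have -> : V `^ n%:R^-1 = 2 * alpha1 / n%:R * K.
  by rewrite /K; field; rewrite !gt_eqF.
have -> : 2 * s = 2 * alpha1 / n%:R * ((d x + K) / 2) by rewrite /s; field; rewrite !gt_eqF.
rewrite leNgt ltr_pM2l ?divr_gt0 ?mulr_gt0// => /negP; apply.
by rewrite ltr_pdivlMr// mulr_natr mulr2n ltrD2r.
Qed.

End anisotropic_distance.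

(** * Directional derivatives over sets invariant under backward translations *)

Section flux.
Context {R : realType} {n : nat}.
Implicit Types (A : set 'rV[R]_n) (e w x : 'rV[R]_n) (g q : 'rV[R]_n -> R).
Local Notation mu := (lebesgue_rV n).

(** After a change of variable, the left-hand side is the integral of q over the
    smaller set of the points whose translate by w is in A. *)
Lemma integral_translation_le A w q :
  measurable A -> (forall x, A x -> A (x - w)) ->
  measurable_fun setT q -> (forall x, 0 <= q x) ->
  (\int[mu]_(x in A) (q (x - w))%:E <= \int[mu]_(x in A) (q x)%:E)%E.
Proof.
move=> mA Aw mq q0.
pose A' := [set x | A (x + w)].
have mA' : measurable A'.
  by rewrite -[X in measurable X]setTI; exact: measurable_fun_addr.
have mE : measurable_fun setT (EFin \o q) by exact/measurable_EFinP.
rewrite integral_mkcond.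
rewrite (_ : (fun x => (q (x - w))%:E) \_ A =
             (fun x => ((EFin \o q) \_ A') (x + (- w)))); last first.
  apply/funext => x; rewrite !patchE; congr (if _ then _ else _).
  by apply/idP/idP; rewrite !inE /A' /= subrK.
rewrite ge0_integral_rV_translation; last 2 first.
- by apply: (measurable_restrictT _ mA').1; exact: measurable_funTS.
- by move=> x; rewrite patchE; case: ifPn => // _; rewrite lee_fin.
rewrite -integral_mkcond; apply: ge0_subset_integral => //.
- exact: measurable_funTS.
- by move=> x _; rewrite lee_fin.
- by move=> x /Aw; rewrite addrK.
Qed.

(** The difference quotients (g(x) - g(x - s e)) / s have nonnegative integral
    over A by [integral_translation_le], and dominated convergence lets s tend
    to 0.  This is the divergence theorem for a set A whose boundary is only
    crossed outwards by e. *)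
Lemma flux_ge0 A e g dg (M0 M r : R) :
  measurable A -> (forall x (s : R), 0 <= s -> A x -> A (x - s *: e)) ->
  measurable_fun setT g -> measurable_fun setT dg ->
  (forall x, 0 <= g x <= M0) -> (forall x, g x != 0 -> `|x| <= r) ->
  (forall x, is_derive x e g (dg x)) -> (forall x, `|dg x| <= M) ->
  mu.-integrable A (EFin \o dg) /\ (0 <= \int[mu]_(x in A) (dg x)%:E)%E.
Proof.
move=> mA Ae mg mdg g0 gr gdg dgM.
pose s k : R := k.+1%:R^-1.
have s0 k : 0 < s k by rewrite invr_gt0.
have s1 k : s k <= 1 by rewrite invf_le1// ler1n.
have M_ge0 : 0 <= M by apply: le_trans (dgM 0).
pose q k x := (s k)^-1 * g x.
pose f k x := q k x - q k (x - s k *: e).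
have mq k : measurable_fun setT (q k) by exact: measurable_funM.
have mqs k : measurable_fun setT (fun x => q k (x - s k *: e)).
  apply: (measurableT_comp (mq k)); exact: measurable_fun_addr.
have mf k : measurable_fun setT (f k) by exact: measurable_funB.
have q0 k x : 0 <= q k x.
  by rewrite mulr_ge0 ?invr_ge0 ?(ltW (s0 k))//; case/andP: (g0 x).
have qM k x : `|q k x| <= (s k)^-1 * M0.
  rewrite ger0_norm//; rewrite ler_wpM2l ?invr_ge0 ?(ltW (s0 k))//.
  by case/andP: (g0 x).
have qr k x : q k x != 0 -> `|x| <= r.
  by rewrite mulf_eq0 negb_or => /andP[_ /gr].
have qrs k x : q k (x - s k *: e) != 0 -> `|x| <= r + `|e|.
  move=> /qr xr; rewrite -(subrK (s k *: e) x).
  apply: le_trans (ler_normD _ _) _; rewrite lerD// normrZ ler_piMl//.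
  by rewrite ger0_norm// ltW.
have iq k : mu.-integrable A (EFin \o q k).
  apply: (@integrableS _ _ _ mu setT) => //.
  exact: integrable_bounded_support (mq k) (qM k) (qr k).
have iqs k : mu.-integrable A (EFin \o (fun x => q k (x - s k *: e))).
  apply: (@integrableS _ _ _ mu setT) => //.
  exact: integrable_bounded_support (mqs k) (fun x => qM k _) (qrs k).
have fM k x : `|f k x| <= M.
  have [c _] := @MVT_R R (fun t => g (t *: e + x)) (fun t => dg (t *: e + x))
    (- s k) 0 (fun t => is_derive_line (gdg _)).
  rewrite scale0r add0r sub0r opprK scaleNr [- _ + x]addrC => E.
  rewrite /f /q -mulrBr.
  by rewrite E mulrC mulfK ?gt_eqF.
have fr k x : f k x != 0 -> `|x| <= r + `|e|.
  have [gx0|/eqP] := eqVneq (q k x) 0.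
    by rewrite /f gx0 sub0r oppr_eq0 => /qrs.
  move=> /eqP/qr xr _; rewrite (le_trans xr)// lerDl//.
pose B := [set y : 'rV[R]_n | forall i, y ord0 i \in
  `[(0 : 'rV[R]_n) ord0 i - `|r + `|e| |, (0 : 'rV[R]_n) ord0 i + `|r + `|e| |]].
have mB : measurable B by exact: measurable_cube.
pose G x : R := M * \1_B x.
have iG : mu.-integrable setT (EFin \o G).
  apply: (@integrable_bounded_support _ _ _ M `|r + `|e| |).
  - by apply: measurable_funM => //; exact: measurable_indic.
  - move=> x; rewrite /G normrM ger0_norm// ler_piMr// indicE.
    by case: (x \in B); rewrite ?normr0 ?normr1.
  - move=> x; rewrite /G indicE; case: (boolP (x \in B)) => [|_]; last first.
      by rewrite mulr0 eqxx.
    rewrite inE => xB _; apply: norm_rV_le => // i.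
    by rewrite ler_norml; have := xB i; rewrite mxE in_itv/= sub0r add0r.
have fG k x : `|f k x| <= G x.
  rewrite /G indicE; case: (boolP (x \in B)) => [_|]; first by rewrite mulr1.
  rewrite notin_setE mulr0 => xB; rewrite normr_le0.
  apply: contra_notT xB => /fr xr i /=.
  rewrite mxE in_itv/= sub0r add0r -ler_norml.
  exact: le_trans (le_coord_norm _ _) (le_trans xr (ler_norm _)).
have fdg x : f ^~ x @ \oo --> dg x.
  apply/cvgrPdist_le => eps eps0.
  have [d d0 dP] := (is_deriveP _ _ _ _).1 (gdg x) eps eps0.
  near=> k.
  have sd : `|- s k| < d.
    rewrite normrN (gtr0_norm (s0 k)); near: k.
    exact: (near_infty_natSinv_lt (PosNum d0)).
  have := dP _ sd; rewrite normrN (gtr0_norm (s0 k)) scaleNr [- _ + x]addrC.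
  rewrite -ler_pdivrMr// -[X in _ / X](gtr0_norm (s0 k)) -normf_div.
  congr (`|_| <= _); rewrite /f /q; field.
  by rewrite gt_eqF.
have cEFin (x : 'rV[R]_n) : (fun k => (f k x)%:E) @ \oo --> (dg x)%:E.
  apply: cvg_EFin; last exact: fdg.
  by apply: nearW => k.
have [idg _ cdg] := @dominated_convergence _ _ _ mu A mA (fun k => EFin \o f k)
  (EFin \o dg) (EFin \o G)
  (fun k => (measurable_EFinP _ _).2 (measurable_funTS (mf k)))
  ((measurable_EFinP _ _).2 (measurable_funTS mdg))
  (aeW _ (fun x _ => cEFin x))
  (integrableS measurableT mA (@subsetT _ A) iG) (aeW _ (fun x k _ => fG k x)).
split=> //; apply: cvge_ge cdg; apply: nearW => k /=.
under eq_integral do rewrite EFinB.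
rewrite integralB_EFin// sube_ge0.
  2: by apply/orP; left; exact: (integrable_fin_num mA (iqs k)).
apply: integral_translation_le => //.
by move=> x; apply: Ae; exact: ltW.
Unshelve. all: by end_near. Qed.

End flux.

(** * The Hardy inequality on one cell *)

Section hardy_weight.
Context {R : realType}.
Implicit Types (L s t m : R).

(** The logarithmic derivative of sqrt(t / (t + L)).  The usual slope 1/(2t)
    yields exactly 1/(4t^2); subtracting the second term leaves a remainder of
    order 1/L^2 for t <= L while keeping the slope positive for all t > 0. *)
Definition hardy_slope L t : R := 2^-1 * (t^-1 - (t + L)^-1).

(** The derivative of [hardy_slope], for t > 0. *)
Definition hardy_dslope L t : R := 2^-1 * ((t + L) ^- 2 - t ^- 2).

(** The value of - h' - h^2 for h = [hardy_slope], written so that its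
    monotonicity is visible. *)
Definition hardy_weight L t : R := L / 4 * ((4 + L / t) / (t * (t + L) ^+ 2)).

Lemma hardy_riccati L t : 0 < L -> 0 < t ->
  - hardy_dslope L t - hardy_slope L t ^+ 2 = hardy_weight L t.
Proof.
move=> L0 t0; rewrite /hardy_dslope /hardy_slope /hardy_weight; field.
by rewrite !gt_eqF// addr_gt0.
Qed.

Lemma hardy_slope_bounds L t m : 0 < L -> 0 < m -> m <= t ->
  0 <= hardy_slope L t <= m^-1.
Proof.
move=> L0 m0 mt; have t0 := lt_le_trans m0 mt.
have tL0 : 0 < t + L by rewrite addr_gt0.
have tLV : (t + L)^-1 <= t^-1 by rewrite lef_pV2 ?posrE// lerDl ltW.
have tV : t^-1 <= m^-1 by rewrite lef_pV2 ?posrE.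
have tLV0 : 0 < (t + L)^-1 by rewrite invr_gt0.
rewrite /hardy_slope; apply/andP; split; first by rewrite mulr_ge0// subr_ge0.
rewrite mulrC ler_pdivrMr//; lra.
Qed.

Lemma hardy_dslope_bound L t m : 0 < L -> 0 < m -> m <= t ->
  `|hardy_dslope L t| <= m ^- 2.
Proof.
move=> L0 m0 mt; have t0 := lt_le_trans m0 mt.
have tL0 : 0 < t + L by rewrite addr_gt0.
have tLV : (t + L) ^- 2 <= t ^- 2.
  by rewrite lef_pV2 ?posrE ?exprn_gt0// lerXn2r ?nnegrE ?(ltW t0) ?(ltW tL0)// lerDl ltW.
have tV : t ^- 2 <= m ^- 2.
  by rewrite lef_pV2 ?posrE ?exprn_gt0// lerXn2r ?nnegrE ?(ltW t0) ?(ltW m0).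
have tLV0 : 0 < (t + L) ^- 2 by rewrite invr_gt0 exprn_gt0.
rewrite /hardy_dslope ler0_norm; last first.
  by rewrite pmulr_rle0// subr_le0.
rewrite -mulrN opprB mulrC ler_pdivrMr//; lra.
Qed.

Lemma hardy_weight_gt0 L t : 0 < L -> 0 < t -> 0 < hardy_weight L t.
Proof.
move=> L0 t0; rewrite /hardy_weight mulr_gt0 ?divr_gt0//.
  by rewrite addr_gt0// divr_gt0.
by rewrite mulr_gt0// exprn_gt0// addr_gt0.
Qed.

Lemma hardy_weight_decr L s t : 0 < L -> 0 < s -> s <= t ->
  hardy_weight L t <= hardy_weight L s.
Proof.
move=> L0 s0 st; have t0 := lt_le_trans s0 st.
rewrite /hardy_weight ler_wpM2l ?divr_ge0 ?(ltW L0)//.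
have sL := addr_gt0 s0 L0; have tL := addr_gt0 t0 L0.
apply: ler_pM.
- by rewrite addr_ge0// divr_ge0// ltW.
- by rewrite invr_ge0 mulr_ge0 ?sqr_ge0// ltW.
- by rewrite lerD2l ler_wpM2l ?(ltW L0)// lef_pV2 ?posrE.
- rewrite lef_pV2 ?posrE ?mulr_gt0 ?exprn_gt0//.
  apply: ler_pM; rewrite ?(ltW s0) ?sqr_ge0//.
  by rewrite lerXn2r ?nnegrE ?(ltW sL) ?(ltW tL)// lerD2r.
Qed.

(** The remainder is (2L - t) / (4 t (t + L)^2), at least L / (4 L (2L)^2). *)
Lemma hardy_weight_ge L t : 0 < t -> t <= L ->
  (4 * t ^+ 2)^-1 + (16 * L ^+ 2)^-1 <= hardy_weight L t.
Proof.
move=> t0 tL; have L0 := lt_le_trans t0 tL.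
have tL0 := addr_gt0 t0 L0.
have -> : hardy_weight L t = (4 * t ^+ 2)^-1 + (2 * L - t) / (4 * t * (t + L) ^+ 2).
  by rewrite /hardy_weight; field; rewrite !gt_eqF.
rewrite lerD2l ler_pdivlMr; last by rewrite !mulr_gt0// exprn_gt0.
rewrite mulrC ler_pdivrMr; last by rewrite mulr_gt0// exprn_gt0.
have t2 : (t + L) ^+ 2 <= (2 * L) ^+ 2.
  by rewrite lerXn2r ?nnegrE ?(ltW tL0)// ?mulr_ge0 ?(ltW L0)//; lra.
have L2 : 0 < L ^+ 2 by rewrite exprn_gt0.
apply: (@le_trans _ _ (4 * t * (2 * L) ^+ 2)).
  by rewrite ler_wpM2l// mulr_ge0// ltW.
rewrite exprMn; have : t * L ^+ 2 <= (2 * L - t) * L ^+ 2.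
  by rewrite ler_wpM2r ?(ltW L2)//; lra.
by move: (L ^+ 2) => a; lra.
Qed.

Lemma measurable_hardy_slope L : measurable_fun setT (hardy_slope L).
Proof.
apply: measurable_funM => //; apply: measurable_funB; first exact: measurable_invr.
by apply: (measurableT_comp measurable_invr); exact: measurable_funD.
Qed.

Lemma measurable_hardy_dslope L : measurable_fun setT (hardy_dslope L).
Proof.
apply: measurable_funM => //; apply: measurable_funB;
  apply: (measurableT_comp measurable_invr); apply: measurable_funX => //.
exact: measurable_funD.
Qed.

Lemma measurable_hardy_weight L : measurable_fun setT (hardy_weight L).
Proof.
apply: measurable_funM => //; apply: measurable_funM.
  apply: measurable_funD => //; apply: measurable_funM => //.
  exact: measurable_invr.
apply: (measurableT_comp measurable_invr); apply: measurable_funM => //.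
by apply: measurable_funX; exact: measurable_funD.
Qed.

Lemma is_derive_hardy_slope (V : normedModType R) (f : V -> R) (x v : V) (df L : R) :
  0 < L -> 0 < f x -> is_derive x v f df ->
  is_derive x v (fun y => hardy_slope L (f y)) (hardy_dslope L (f x) * df).
Proof.
move=> L0 fx0 dfx.
have isV (k : V -> R) (dk : R) : k x != 0 -> is_derive x v k dk ->
    is_derive x v (fun y => (k y)^-1) (- (k x) ^- 2 * dk).
  move=> k0 [dk1 dk2]; apply: DeriveDef; first exact: derivableV.
  by rewrite deriveV// dk2.
have d1 := isV _ _ (lt0r_neq0 fx0) dfx.
have dfL : is_derive x v (fun y => f y + L) df.
  have := is_deriveD dfx (is_derive_cst L x v); rewrite addr0; exact.
have d2 := isV _ _ (lt0r_neq0 (addr_gt0 fx0 L0)) dfL.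
have := is_deriveZ (2^-1) (is_deriveB d1 d2).
congr is_derive.
rewrite /hardy_dslope -[_ *: _]/(_ * _) -mulrA; congr (_ * _).
by rewrite mulrBl !mulNr opprK addrC.
Qed.

End hardy_weight.

Lemma is_derive_dot {R : realType} {n : nat} (nu x v : 'rV[R]_n) :
  is_derive x v (dot nu) (dot nu v).
Proof.
apply/is_deriveP => e e0; exists 1 => // h _.
by rewrite dotDr dotZr addrK subrr normr0 mulr_ge0// ltW.
Qed.

Section cells.
Context {R : realType} {n : nat}.
Local Notation mu := (lebesgue_rV n).
Implicit Types (x v e nu : 'rV[R]_n) (A : set 'rV[R]_n).

Lemma bounded_of_support (S : set 'rV[R]_n) (f : 'rV[R]_n -> R) :
  compact S -> continuous f -> (forall x, ~ S x -> f x = 0) ->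
  exists2 M : R, 0 <= M & forall x, `|f x| <= M.
Proof.
move=> cS cf f0; have [S0|/set0P S0] := eqVneq S set0.
  by exists 0 => // x; rewrite f0 ?normr0// S0.
have cnf : {within S, continuous (fun x => `|f x|)}.
  apply: continuous_subspaceT => x.
  by apply: (@continuous_comp _ _ _ f (fun y : R => `|y|)); [exact: cf|exact: norm_continuous].
have [c _ cP] := EVT_max_rV S0 cS cnf.
exists `|f c| => // x; have [Sx|Sx] := pselect (S x); last by rewrite f0 ?normr0.
by apply: cP; rewrite inE.
Qed.

Lemma compact_norm_le (S : set 'rV[R]_n) : compact S ->
  exists r : R, forall x, S x -> `|x| <= r.
Proof.
by move=> /compact_bounded/bounded_setP[r _ rP]; exists r.
Qed.

Variable phi : 'rV[R]_n -> R.
Hypothesis cphi : continuous phi.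
Hypothesis dphi : forall (i : 'I_n) x, derivable phi x (delta_mx ord0 i).
Hypothesis cdphi : forall i : 'I_n, continuous (partial i phi).
Let S := closure [set x | phi x != 0].
Hypothesis cS : compact S.

Let phi0 x : ~ S x -> phi x = 0.
Proof.
by move=> Sx; apply/eqP; apply: contra_notT Sx => h; exact: subset_closure.
Qed.

Let near_phi0 x : ~ S x -> \forall y \near x, phi y = 0.
Proof.
move=> Sx; have : nbhs x (~` S).
  by apply: open_nbhs_nbhs; split => //; apply: closed_openC; exact: closed_closure.
by apply: (@filterS _ (nbhs x)) => y; exact: phi0.
Qed.

Lemma grad_out_of_support x : ~ closure [set x | phi x != 0] x -> grad phi x = 0.
Proof.
move=> Sx; apply/rowP => i; rewrite !mxE /partial.
rewrite (near_eq_derive (g := cst 0)); first by rewrite derive_cst.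
exact: near_phi0.
Qed.

Lemma measurable_grad : measurable_fun setT (grad phi).
Proof.
apply/measurable_fun_rVP => i.
rewrite [X in measurable_fun _ X](_ : _ = partial i phi).
  exact: continuous_measurable_rV.
by apply/funext => x /=; rewrite mxE.
Qed.

Variables (alpha1 : R) (F : 'rV[R]_n -> R).
Hypothesis FP : anisotropic_norm alpha1 F.

Lemma measurable_aniso_grad : measurable_fun setT (fun x => F (grad phi x)).
Proof.
have mF := continuous_measurable_rV (aniso_continuous FP).
exact: (measurableT_comp mF measurable_grad).
Qed.

(** [flux_ge0] for g = phi^2 h(l), where l(x) = nu . x - c has derivative 1 along
    e = grad F(nu); then 2 p q h - p^2 h^2 <= q^2 with p = phi and
    q = D_e phi, and |D_e phi| <= F(grad phi). *)
Lemma cell_hardy A nu (c m L : R) : F nu = 1 -> 0 < m -> 0 < L ->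
  (forall z, closure [set x | phi x != 0] z -> m <= dot nu z - c) ->
  measurable A ->
  (forall x (s : R), 0 <= s -> A x -> A (x - s *: grad F nu)) ->
  (\int[mu]_(x in A) (hardy_weight L (dot nu x - c) * phi x ^+ 2)%:E <=
   \int[mu]_(x in A) (F (grad phi x) ^+ 2)%:E)%E.
Proof.
move=> Fnu m0 L0 ml mA Ae.
have nu0 : nu != 0.
  by apply/eqP => nuE; move: Fnu; rewrite nuE (aniso0 FP) => /esym/eqP; rewrite oner_eq0.
set e := grad F nu in Ae.
pose l x := dot nu x - c.
have lS x : S x -> 0 < l x by move=> /ml; exact: lt_le_trans.
pose D x := dot e (grad phi x).
have DS x : ~ S x -> D x = 0 by move=> Sx; rewrite /D grad_out_of_support// dotC dot0l.
have cD : continuous D.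
  apply: dot_continuous_comp => i.
  rewrite (_ : (fun t => _) = partial i phi)//.
  by apply/funext => x; rewrite mxE.
have cl : continuous l.
  move=> x; apply: continuousB; first exact: dot_continuous.
  exact: cst_continuous.
have ml' : measurable_fun setT l by exact: continuous_measurable_rV.
have mphi : measurable_fun setT phi by exact: continuous_measurable_rV.
have mD : measurable_fun setT D by exact: continuous_measurable_rV.
have [Mp Mp0 phiM] := bounded_of_support cS cphi phi0.
have [MD MD0 DM] := bounded_of_support cS cD DS.
have [r rS] := compact_norm_le cS.
have outS (P : 'rV[R]_n -> R) x : (~ S x -> P x = 0) -> P x != 0 -> `|x| <= r.
  by move=> PS Px; apply: rS; apply: contrapT => /PS Px0; rewrite Px0 eqxx in Px.
pose g x := phi x ^+ 2 * hardy_slope L (l x).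
pose dg x := 2 * phi x * D x * hardy_slope L (l x) + phi x ^+ 2 * hardy_dslope L (l x).
pose w x := hardy_weight L (l x) * phi x ^+ 2.
have gS x : ~ S x -> g x = 0 by move=> /phi0 h; rewrite /g h expr0n mul0r.
have dgS x : ~ S x -> dg x = 0.
  by move=> /phi0 h; rewrite /dg h expr0n !(mul0r, mulr0) addr0.
have wS x : ~ S x -> w x = 0 by move=> /phi0 h; rewrite /w h expr0n mulr0.
have mg : measurable_fun setT g.
  apply: measurable_funM; first exact: measurable_funX.
  exact: (measurableT_comp (measurable_hardy_slope L)).
have mdg : measurable_fun setT dg.
  apply: measurable_funD; apply: measurable_funM.
  - by apply: measurable_funM => //; exact: measurable_funM.
  - exact: (measurableT_comp (measurable_hardy_slope L)).
  - exact: measurable_funX.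
  - exact: (measurableT_comp (measurable_hardy_dslope L)).
have mw : measurable_fun setT w.
  apply: measurable_funM; last exact: measurable_funX.
  exact: (measurableT_comp (measurable_hardy_weight L)).
have sqr_le (a b : R) : `|a| <= b -> a ^+ 2 <= b ^+ 2.
  by move=> ab; rewrite -[a ^+ 2]real_normK ?num_real// lerXn2r ?nnegrE ?(le_trans _ ab).
have phi2 x : phi x ^+ 2 <= Mp ^+ 2 by exact: sqr_le.
have g0 x : 0 <= g x <= Mp ^+ 2 * m^-1.
  have [Sx|/gS ->] := pselect (S x); last first.
    by rewrite lexx mulr_ge0 ?sqr_ge0 ?invr_ge0 ?(ltW m0).
  have /andP[h1 h2] : 0 <= hardy_slope L (l x) <= m^-1.
    exact: hardy_slope_bounds L0 m0 (ml _ Sx).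
  by rewrite mulr_ge0 ?sqr_ge0//= ler_pM ?sqr_ge0.
have dgM x : `|dg x| <= 2 * Mp * MD * m^-1 + Mp ^+ 2 * m ^- 2.
  have [Sx|/dgS ->] := pselect (S x); last first.
    by rewrite normr0 addr_ge0// !mulr_ge0 ?invr_ge0 ?sqr_ge0 ?(ltW m0).
  have /andP[h1 h2] : 0 <= hardy_slope L (l x) <= m^-1.
    exact: hardy_slope_bounds L0 m0 (ml _ Sx).
  have h3 : `|hardy_dslope L (l x)| <= m ^- 2.
    exact: hardy_dslope_bound L0 m0 (ml _ Sx).
  apply: le_trans (ler_normD _ _) _; apply: lerD.
    rewrite normrM (ger0_norm h1) normrM normrM [`|2|]ger0_norm//.
    by apply: ler_pM => //; rewrite ?mulr_ge0// ler_pM ?mulr_ge0// ler_wpM2l.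
  by rewrite normrM normrX ler_pM// lerXn2r ?nnegrE.
have gdg x : is_derive x e g (dg x).
  have [Sx|Sx] := pselect (S x); last first.
    rewrite dgS//.
    have d0 := is_derive_cst (0 : R) x e.
    apply: near_eq_is_derive d0.
    move: (near_phi0 Sx); apply: (@filterS _ (nbhs x)) => y yphi.
    by rewrite /g yphi expr0n mul0r.
  have dl : is_derive x e l 1.
    have := is_deriveB (is_derive_dot nu x e) (is_derive_cst c x e).
    by rewrite subr0 /e (dot_grad_aniso FP)// Fnu.
  have dsl := is_derive_hardy_slope L0 (lS _ Sx) dl.
  have dp := C1_is_derive dphi cdphi x e.
  have := is_deriveM (is_deriveM dp dp) dsl.
  rewrite (_ : phi * phi * _ = g); last by apply/funext => y.
  move=> H; apply: (is_derive_eq H).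
  rewrite /dg -/(D x) -![_ *: _]/(_ * _) /= mulr1.
  rewrite -[(phi * phi) x]/(phi x * phi x).
  by move: (hardy_slope _ _) (hardy_dslope _ _) => a b; ring.
have [idg dg_ge0] := flux_ge0 mA Ae mg mdg g0 (fun x => @outS g x (@gS x)) gdg dgM.
have iw : mu.-integrable A (EFin \o w).
  apply: (integrableS measurableT mA (@subsetT _ A)).
  apply: (@integrable_bounded_support _ _ _ (hardy_weight L m * Mp ^+ 2) r) => // x.
    have [Sx|/wS ->] := pselect (S x); last first.
      by rewrite normr0 mulr_ge0 ?sqr_ge0// ltW// hardy_weight_gt0.
    have w0 := hardy_weight_gt0 L0 (lS _ Sx).
    rewrite ger0_norm; last by rewrite mulr_ge0 ?sqr_ge0 ?(ltW w0).
    apply: ler_pM; rewrite ?sqr_ge0 ?(ltW w0)//.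
    by apply: hardy_weight_decr => //; exact: ml.
  by apply: (@outS w x); exact: wS.
have iD : mu.-integrable A (EFin \o (fun x => D x ^+ 2)).
  apply: (integrableS measurableT mA (@subsetT _ A)).
  apply: (@integrable_bounded_support _ _ _ (MD ^+ 2) r).
  - exact: measurable_funX.
  - by move=> x; rewrite normrX lerXn2r ?nnegrE.
  - by move=> x; apply: (@outS (fun x => D x ^+ 2) x) => /DS ->; rewrite expr0n.
have dgwD x : dg x + w x <= D x ^+ 2.
  have [Sx|Sx] := pselect (S x); last by rewrite dgS// wS// addr0 sqr_ge0.
  rewrite /w -hardy_riccati//; last exact: lS.
  rewrite /dg -subr_ge0 [leRHS](_ : _ = (D x - phi x * hardy_slope L (l x)) ^+ 2) ?sqr_ge0//.
  by move: (hardy_slope _ _) (hardy_dslope _ _) (D x) (phi x) => a b p q; ring.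
apply: (@le_trans _ _ (\int[mu]_(x in A) (dg x)%:E + \int[mu]_(x in A) (w x)%:E)%E).
  by rewrite leeDr.
rewrite -integralD_EFin//.
apply: (@le_trans _ _ (\int[mu]_(x in A) (D x ^+ 2)%:E)%E).
  apply: le_integral => //; first exact: integrableD.
  by move=> x _; rewrite /= -EFinD lee_fin.
apply: ge0_le_integral => //.
- by move=> x _; rewrite lee_fin sqr_ge0.
- by apply/measurable_EFinP/measurable_funTS; exact: measurable_funX.
- apply/measurable_EFinP/measurable_funTS; apply: measurable_funX.
  exact: measurable_aniso_grad.
- move=> x _; rewrite lee_fin; apply: sqr_le.
  by rewrite /D dotC; exact: (abs_dot_grad_aniso_le FP).
Qed.

End cells.

(** * Minimality cells of a finite family of affine functions *)

Section finite_family.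
Context {R : realType} {n : nat}.
Local Notation mu := (lebesgue_rV n).
Variables (N : nat) (l : 'I_N.+1 -> 'rV[R]_n -> R).

(** Ties are broken in favour of the smallest index, so that the cells form a
    partition. *)
Definition cell (i : 'I_N.+1) : set 'rV[R]_n :=
  [set x | forall j, (l i x <= l j x) /\ ((j < i)%N -> l i x < l j x)].

Lemma cell_cover x : exists i, cell i x.
Proof.
pose P k := [exists i : 'I_N.+1, (val i == k) && [forall j, l i x <= l j x]].
have exP : exists k, P k.
  pose i0 := [arg min_(i < ord0) l i x]%O.
  exists (val i0); apply/existsP; exists i0; rewrite eqxx /=.
  apply/forallP => j; rewrite /i0; case: arg_minP => // i _; exact.
have [k /existsP[i /andP[/eqP ik /forallP il]] kmin] := ex_minnP exP.
exists i => j; split => // ji; rewrite ltNge; apply/negP => lji.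
have : P j.
  apply/existsP; exists j; rewrite eqxx /=; apply/forallP => j'.
  exact: le_trans lji (il j').
by move=> /kmin; rewrite -ik leqNgt ji.
Qed.

Lemma cell_disjoint i j x : cell i x -> cell j x -> i = j.
Proof.
have H a b : cell a x -> cell b x -> ~ (a < b)%N.
  by move=> /(_ b)[ab _] /(_ a)[_ ba] /ba; rewrite ltNge ab.
move=> ci cj; apply: ord_inj; apply/eqP; rewrite eqn_leq.
by apply/andP; split; rewrite leqNgt; apply/negP; exact: H.
Qed.

Hypothesis cl : forall i, continuous (l i).

Lemma measurable_cell i : measurable (cell i).
Proof.
have mB j : measurable_fun setT (fun x => l j x - l i x).
  by apply: measurable_funB; exact: continuous_measurable_rV.
rewrite (_ : cell i = \bigcap_(j in [set: 'I_N.+1])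
   ((fun x => l j x - l i x) @^-1`
      (if (j < i)%N then `]0, +oo[%classic else `[0, +oo[%classic))).
  apply: fin_bigcap_measurable => // j _.
  rewrite -[X in measurable X]setTI; apply: mB => //.
  by case: ifPn => _; exact: measurable_itv.
apply/seteqP; split => x /= H j.
  move=> _; have [H1 H2] := H j.
  by case: ifPn => ji; rewrite /= in_itv/= andbT ?subr_gt0 ?subr_ge0// H2.
have := H j I; case: ifPn => ji; rewrite /= in_itv/= andbT ?subr_gt0 ?subr_ge0.
  by move=> h; split => //; exact: ltW.
by move=> h; split => //; rewrite (negbTE ji).
Qed.

Lemma integral_cells (f : 'rV[R]_n -> R) :
  measurable_fun setT f -> (forall x, 0 <= f x) ->
  (\int[mu]_x (f x)%:E = \sum_(i < N.+1) \int[mu]_(x in cell i) (f x)%:E)%E.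
Proof.
move=> mf f0.
rewrite -(@ge0_integral_bigsetU _ _ _ mu _ cell (EFin \o f) (index_enum 'I_N.+1)).
- congr (integral _ _ _); apply/seteqP; split => // x _.
  have [i ix] := cell_cover x.
  by rewrite -bigcup_seq; exists i => //=; rewrite mem_index_enum.
- exact: measurable_cell.
- exact: index_enum_uniq.
- by move=> i j _ _ [x [ix jx]]; exact: cell_disjoint ix jx.
- by apply/measurable_EFinP; exact: measurable_funTS.
- by move=> x _; rewrite lee_fin.
Qed.

End finite_family.

Section hardy_test_function.
Context {R : realType} {n : nat} (alpha1 : R) (F : 'rV[R]_n -> R).
Local Notation mu := (lebesgue_rV n).
Hypothesis FP : anisotropic_norm alpha1 F.

Variable phi : 'rV[R]_n -> R.
Hypothesis cphi : continuous phi.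
Hypothesis dphi : forall (i : 'I_n) x, derivable phi x (delta_mx ord0 i).
Hypothesis cdphi : forall i : 'I_n, continuous (partial i phi).
Let S := closure [set x | phi x != 0].
Hypothesis cS : compact S.

Let phi0 x : ~ S x -> phi x = 0.
Proof.
by move=> Sx; apply/eqP; apply: contra_notT Sx => h; exact: subset_closure.
Qed.

(** On the i-th cell l_i <= delta, and the weight is decreasing, so the sum of the
    inequalities [cell_hardy] bounds the weighted integral.  Each cell is
    invariant under backward translations along grad F(nu_i) because l_i
    decreases there at speed 1 and l_j at speed at most F(nu_j) = 1. *)
Lemma hardy_finite_family N (nu : 'I_N.+1 -> 'rV[R]_n) (c m : 'I_N.+1 -> R)
    (delta : 'rV[R]_n -> R) (L : R) :
  0 < L -> measurable_fun setT delta -> (forall x, 0 < delta x) ->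
  (forall i, F (nu i) = 1) -> (forall i, 0 < m i) ->
  (forall i x, S x -> m i <= dot (nu i) x - c i) ->
  (forall x, S x -> exists i, dot (nu i) x - c i <= delta x) ->
  (\int[mu]_x (hardy_weight L (delta x) * phi x ^+ 2)%:E <=
   \int[mu]_x (F (grad phi x) ^+ 2)%:E)%E.
Proof.
move=> L0 mdelta delta0 Fnu m0 ml ldelta.
pose l i x := dot (nu i) x - c i.
have cl i : continuous (l i).
  move=> x; apply: continuousB; first exact: dot_continuous.
  exact: cst_continuous.
have mphi : measurable_fun setT phi by exact: continuous_measurable_rV.
have mW (k : 'rV[R]_n -> R) : measurable_fun setT k ->
    measurable_fun setT (fun x => hardy_weight L (k x) * phi x ^+ 2).
  move=> mk; apply: measurable_funM; last exact: measurable_funX.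
  exact: (measurableT_comp (measurable_hardy_weight L)).
rewrite (integral_cells cl); last 2 first.
- exact: mW.
- by move=> x; rewrite mulr_ge0 ?sqr_ge0// ltW// hardy_weight_gt0.
rewrite (integral_cells cl); last 2 first.
- by apply: measurable_funX; exact: measurable_aniso_grad FP.
- by move=> x; rewrite sqr_ge0.
apply: lee_sum => i _.
apply: le_trans (@cell_hardy R n phi cphi dphi cdphi cS alpha1 F FP (cell l i)
  (nu i) (c i) (m i) L (Fnu i) (m0 i) L0 (ml i) (measurable_cell cl i) _).
  have lw x : S x -> 0 < l i x by move=> Sx; exact: lt_le_trans (m0 i) (ml i x Sx).
  apply: ge0_le_integral.
  - exact: measurable_cell.
  - by move=> x _; rewrite lee_fin mulr_ge0 ?sqr_ge0// ltW// hardy_weight_gt0.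
  - by apply/measurable_EFinP/measurable_funTS; exact: mW.
  - apply/measurable_EFinP/measurable_funTS; apply: mW.
    exact: (continuous_measurable_rV (cl i)).
  - move=> x ix; rewrite lee_fin; have [Sx|/phi0 ->] := pselect (S x); last first.
      by rewrite expr0n !mulr0.
    rewrite ler_wpM2r ?sqr_ge0// hardy_weight_decr ?lw//.
    by have [j] := ldelta _ Sx; apply: le_trans; have [] := ix j.
move=> x s s0 ix j; have [h1 h2] := ix j.
(* l_i - l_j does not increase when moving backwards along grad F (nu i). *)
have nuj : dot (nu j) (grad F (nu i)) <= 1.
  rewrite -(Fnu j); apply: (dot_grad_aniso_le FP).
  by apply/eqP => nuE; move: (Fnu i); rewrite nuE (aniso0 FP) => /esym/eqP; rewrite oner_eq0.
have nui : dot (nu i) (grad F (nu i)) = 1.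
  rewrite (dot_grad_aniso FP) ?Fnu//.
  by apply/eqP => nuE; move: (Fnu i); rewrite nuE (aniso0 FP) => /esym/eqP; rewrite oner_eq0.
have E : l i (x - s *: grad F (nu i)) - l j (x - s *: grad F (nu i)) <= l i x - l j x.
  rewrite /l !dotBr !dotZr nui.
  have : s * dot (nu j) (grad F (nu i)) <= s * 1 by rewrite ler_wpM2l.
  by move: (s * dot _ _) => a; lra.
split; first by rewrite -subr_le0 (le_trans E)// subr_le0.
by move=> /h2 h; rewrite -subr_lt0 (le_lt_trans E)// subr_lt0.
Qed.

End hardy_test_function.

(** * The Hardy inequality for test functions *)

Section hardy_distance.
Context {R : realType} {n : nat} (alpha1 : R) (F : 'rV[R]_n -> R).
Variable Omega : set 'rV[R]_n.
Hypothesis alpha1_gt0 : 0 < alpha1.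
Hypothesis FP : anisotropic_norm alpha1 F.
Hypothesis OP : domain Omega.
Hypothesis cO : convex_set Omega.
Hypothesis bO : bounded_set Omega.
Local Notation mu := (lebesgue_rV n).
Local Notation d := (anisotropic_dist F Omega).
Implicit Types (x z : 'rV[R]_n) (phi : 'rV[R]_n -> R).

Let mO : measurable Omega.
Proof. by apply: open_measurable_rV; case: OP. Qed.

Lemma test_functionP phi : test_function Omega phi ->
  [/\ continuous phi, forall (i : 'I_n) x, derivable phi x (delta_mx ord0 i) &
      forall i : 'I_n, continuous (partial i phi)].
Proof.
case=> /(_ 1%N) [cphi H] _ _; split.
- by move=> x; exact: cphi.
- by move=> i x; have [+ _] := H i; exact.
- by move=> i x; have [_ [+ _]] := H i; exact.
Qed.

(** The sets where one of the functions of [supporting_halfspace] is smaller than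
    d + e form an open cover of the support of phi. *)
Lemma hardy_test phi (e L : R) : test_function Omega phi -> 0 < e -> 0 < L ->
  (\int[mu]_(x in Omega) (hardy_weight L (d x + e) * phi x ^+ 2)%:E <=
   \int[mu]_(x in Omega) (F (grad phi x) ^+ 2)%:E)%E.
Proof.
move=> tphi e0 L0; have [cphi dphi cdphi] := test_functionP tphi.
have [_ cS SO] := tphi; set S := closure _ in cS SO.
have d0 x : 0 < d x + e by rewrite ltr_wpDl// (aniso_dist_ge0 alpha1_gt0 FP OP).
have cd : continuous d by exact: aniso_dist_continuous alpha1_gt0 FP OP.
have H x : {p : 'rV[R]_n * R * R | Omega x ->
    [/\ F p.1.1 = 1, 0 < p.2, forall z, Omega z -> p.2 <= dot p.1.1 z - p.1.2 &
        dot p.1.1 x - p.1.2 < d x + e]}.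
  have [Ox|Ox] := pselect (Omega x); last by exists (0, 0, 0).
  have [nu /cid[c /cid[m P]]] :=
    cid (supporting_halfspace alpha1_gt0 FP OP cO bO Ox e0).
  by exists (nu, c, m).
pose p x := sval (H x).
have pP x : Omega x -> [/\ F (p x).1.1 = 1, 0 < (p x).2,
    forall z, Omega z -> (p x).2 <= dot (p x).1.1 z - (p x).1.2 &
    dot (p x).1.1 x - (p x).1.2 < d x + e] by exact: (svalP (H x)).
pose l x z := dot (p x).1.1 z - (p x).1.2.
have cl x : continuous (l x).
  move=> z; apply: continuousB; first exact: dot_continuous.
  exact: cst_continuous.
pose U x := [set z | 0 < d z + e - l x z].
have cU x : continuous (fun z => d z + e - l x z).
  move=> z; apply: (@continuousB _ _ _ (fun z => d z + e) (l x)); last exact: cl.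
  by apply: (@continuousD _ _ _ d (cst e)); [exact: cd|exact: cst_continuous].
have oU x : Omega x -> open (U x).
  move=> _; rewrite (_ : U x = (fun z => d z + e - l x z) @^-1` [set y | 0 < y])//.
  by apply: open_comp; [move=> z _; exact: cU|exact: open_gt].
move: (cS); rewrite compact_cover => /(_ _ Omega U oU)[].
  move=> x /SO Ox; exists x => //; rewrite /U /= subr_gt0.
  by have [] := pP _ Ox.
move=> D DO SD.
have [x0 Ox0] := domain_nonempty OP.
pose s := x0 :: finmap.enum_fset D.
have sO (i : 'I_(size (finmap.enum_fset D)).+1) : Omega (nth x0 s i).
  have : nth x0 s i \in s by rewrite mem_nth//= ltn_ord.
  by rewrite inE => /orP[/eqP ->//|/DO]; rewrite inE.
have md : measurable_fun setT (fun x => d x + e).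
  by apply: measurable_funD => //; exact: continuous_measurable_rV.
have := @hardy_finite_family R n alpha1 F FP phi cphi dphi cdphi cS
  (size (finmap.enum_fset D)) (fun i => (p (nth x0 s i)).1.1)
  (fun i => (p (nth x0 s i)).1.2) (fun i => (p (nth x0 s i)).2)
  (fun x => d x + e) L L0 md d0.
have -> : (\int[mu]_x (F (grad phi x) ^+ 2)%:E =
           \int[mu]_(x in Omega) (F (grad phi x) ^+ 2)%:E)%E.
  rewrite [RHS]integral_mkcond; apply: eq_integral => x _; rewrite patchE.
  case: ifPn => //; rewrite notin_setE => Ox.
  by rewrite grad_out_of_support ?(aniso0 FP) ?expr0n// => /SO.
move=> HH; apply: (le_trans _ (HH _ _ _ _)).
- apply: ge0_subset_integral => //.
  + apply/measurable_EFinP; apply: measurable_funM.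
      exact: (measurableT_comp (measurable_hardy_weight L) md).
    by apply: measurable_funX; exact: continuous_measurable_rV.
  + by move=> x _; rewrite lee_fin mulr_ge0 ?sqr_ge0// ltW// hardy_weight_gt0.
- by move=> i; have [] := pP _ (sO i).
- by move=> i; have [] := pP _ (sO i).
- by move=> i x /SO Ox; have [_ _ + _] := pP _ (sO i); exact.
- move=> x /SD[y /= yD]; rewrite /U /= subr_gt0 => /ltW lx.
  have ys : (index y s < (size (finmap.enum_fset D)).+1)%N.
    by rewrite index_mem inE yD orbT.
  by exists (Ordinal ys); rewrite nth_index// inE yD orbT.
Qed.

(** The polar norm dominates a multiple of the sup norm, and a sup-norm ball
    around x avoids the boundary. *)
Lemma aniso_dist_gt0 x : Omega x -> 0 < d x.
Proof.
move=> Ox; have [oO _ _] := OP; have n_gt0 := domain_dim_gt0 OP.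
have [r r0 rO] := open_normP oO Ox.
have B0 := aniso_bound_ge0 FP.
have B1 : 0 < aniso_bound F + 1 by rewrite ltr_wpDl.
apply: (@lt_le_trans _ _ (r / (aniso_bound F + 1))); first by rewrite divr_gt0.
apply: (aniso_dist_ge alpha1_gt0 FP OP) => y yO; rewrite ler_pdivrMr//.
have rxy : r <= `|x - y|.
  by rewrite leNgt; apply/negP => /rO; exact: boundary_notin yO.
apply: (le_trans rxy); set v := x - y.
have v0 : 0 < `|v| by exact: lt_le_trans r0 rxy.
have vv : `|v| ^+ 2 <= dot v v.
  by rewrite -sqr_enorm lerXn2r ?nnegrE ?enorm_ge0// le_norm_enorm.
have P0 := polar_ge0 alpha1_gt0 FP n_gt0 v.
have := le_trans vv (dot_le_polar alpha1_gt0 FP v v).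
move=> /le_trans/(_ (ler_wpM2r P0 (aniso_le_norm FP v))).
rewrite expr2 [_ * `|v| * _]mulrAC [leRHS]mulrC ler_pM2l// => /le_trans; apply.
by rewrite mulrC ler_wpM2l// lerDl.
Qed.

Lemma domain_volume_gt0 : (0 < lebesgue_rV n Omega)%E.
Proof.
have n_gt0 := domain_dim_gt0 OP.
have [x Ox] := domain_nonempty OP; have dx := aniso_dist_gt0 Ox.
have nR : 0 < n%:R :> R by rewrite ltr0n.
pose s := alpha1 / n%:R * (d x / 2).
have s0 : 0 < s by rewrite !mulr_gt0 ?invr_gt0.
have sd : n%:R / alpha1 * s < d x.
  rewrite (_ : _ * s = d x / 2) ?ltr_pdivrMr ?ltr_pMr ?ltr1n//.
  by rewrite /s; field; rewrite !gt_eqF.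
have h := cube_le_volume alpha1_gt0 FP OP bO Ox (ltW s0) sd.
rewrite -[ltRHS]fineK; last by rewrite ge0_fin_numE// domain_volume_lty.
by rewrite lte_fin (lt_le_trans _ h)// exprn_gt0// mulr_gt0.
Qed.

End hardy_distance.

(** * Passage to H^1_0 *)

Section H10_limit.
Context {R : realType} {n : nat}.
Local Notation mu := (lebesgue_rV n).
Implicit Types (D : set 'rV[R]_n) (f g h : 'rV[R]_n -> R).

Lemma ge0_integral_lin_le D f g h (a b : R) : measurable D ->
  measurable_fun D f -> measurable_fun D g -> measurable_fun D h ->
  (forall x, 0 <= f x) -> (forall x, 0 <= g x) -> (forall x, 0 <= h x) ->
  0 <= a -> 0 <= b ->
  (forall x, D x -> h x <= a * f x + b * g x) ->
  (\int[mu]_(x in D) (h x)%:E <=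
   a%:E * \int[mu]_(x in D) (f x)%:E + b%:E * \int[mu]_(x in D) (g x)%:E)%E.
Proof.
move=> mD mf mg mh f0 g0 h0 a0 b0 H.
rewrite -!ge0_integralZl_EFin//; try (by move=> x _; rewrite lee_fin);
  try exact/measurable_EFinP.
rewrite -ge0_integralD//; try (by move=> x _; rewrite -EFinM lee_fin mulr_ge0);
  try by (apply/measurable_EFinP; exact: measurable_funM).
apply: ge0_le_integral => //.
- by move=> x _; rewrite lee_fin.
- exact/measurable_EFinP.
- by apply/measurable_EFinP; apply: measurable_funD; exact: measurable_funM.
Qed.

Lemma measurable_fun_rV_on D (v : 'rV[R]_n -> 'rV[R]_n) : measurable D ->
  (forall i, measurable_fun D (fun x => v x ord0 i)) -> measurable_fun D v.
Proof.
move=> mD mv; pose w x := if x \in D then v x else 0.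
have mw : measurable_fun setT w.
  apply/measurable_fun_rVP => i.
  apply: eq_measurable_fun ((measurable_restrictT _ mD).1 (mv i)) => x _ /=.
  by rewrite /w /patch; case: ifPn => // _; rewrite mxE.
apply: (@eq_measurable_fun _ _ _ _ D w); last exact: measurable_funTS.
by move=> x xD; rewrite /w xD.
Qed.

Lemma young (a b t : R) : 0 < t -> (a + b) ^+ 2 <= (1 + t) * a ^+ 2 + (1 + t^-1) * b ^+ 2.
Proof.
move=> t0; rewrite -subr_ge0.
have -> : (1 + t) * a ^+ 2 + (1 + t^-1) * b ^+ 2 - (a + b) ^+ 2 =
  t^-1 * (t * a - b) ^+ 2 by field; rewrite gt_eqF.
by rewrite mulr_ge0 ?sqr_ge0// invr_ge0 ltW.
Qed.

Variables (alpha1 : R) (F : 'rV[R]_n -> R).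
Hypothesis FP : anisotropic_norm alpha1 F.
Variable Omega : set 'rV[R]_n.
Hypothesis mO : measurable Omega.
Variables (u : 'rV[R]_n -> R) (Du : 'rV[R]_n -> 'rV[R]_n).
Hypothesis uP : H10 Omega u Du.

Let mu_ : measurable_fun Omega u.
Proof. by case: uP => -[[]]. Qed.

Let mDu : measurable_fun Omega Du.
Proof. by apply: measurable_fun_rV_on => // i; case: uP => -[_ /(_ i)[]]. Qed.

Lemma measurable_aniso_on (v : 'rV[R]_n -> 'rV[R]_n) :
  measurable_fun Omega v -> measurable_fun Omega (fun x => F (v x)).
Proof.
have mF := continuous_measurable_rV (aniso_continuous FP).
exact: (measurableT_comp mF).
Qed.

Let B := aniso_bound F.

Let F_le_enorm x : F x <= B * enorm x.
Proof.
apply: le_trans (aniso_le_norm FP x) _.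
by rewrite ler_wpM2l ?(aniso_bound_ge0 FP)// le_norm_enorm.
Qed.

Lemma integral_aniso_Du_lty : (\int[mu]_(x in Omega) (F (Du x) ^+ 2)%:E < +oo)%E.
Proof.
have [[_ LDu _] _] := uP.
apply: (@le_lt_trans _ _ (\int[mu]_(x in Omega)
    (\sum_(i < n) (B ^+ 2)%:E * (Du x ord0 i ^+ 2)%:E))%E).
  apply: ge0_le_integral => //.
  - by move=> x _; rewrite lee_fin sqr_ge0.
  - apply/measurable_EFinP; apply: measurable_funX.
    exact: measurable_aniso_on.
  - apply: emeasurable_fun_sum => i; apply: emeasurable_funM => //.
    apply/measurable_EFinP; apply: measurable_funX.
    by case: (LDu i).
  - move=> x _; under eq_bigr do rewrite -EFinM; rewrite sumEFin lee_fin -mulr_sumr.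
    rewrite (eq_bigr (fun i => Du x ord0 i * Du x ord0 i)) => [|i _]; last exact: expr2.
    rewrite -/(dot _ _) -sqr_enorm -exprMn lerXn2r ?nnegrE ?(aniso_ge0 FP)//.
    by rewrite mulr_ge0 ?enorm_ge0 ?(aniso_bound_ge0 FP).
rewrite ge0_integral_sum//.
- apply: lte_sum_pinfty => i _; rewrite ge0_integralZl_EFin ?sqr_ge0//.
  + by rewrite lte_mul_pinfty ?lee_fin ?sqr_ge0//; case: (LDu i).
  + by move=> x _; rewrite lee_fin sqr_ge0.
  + by apply/measurable_EFinP; apply: measurable_funX; case: (LDu i).
- move=> i; apply: emeasurable_funM => //.
  by apply/measurable_EFinP; apply: measurable_funX; case: (LDu i).
- by move=> i x _; rewrite -EFinM lee_fin mulr_ge0 ?sqr_ge0.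
Qed.

(** Both sides are compared with those for an approximating test function phi_k
    by (a + b)^2 <= (1 + t) a^2 + (1 + 1/t) b^2; the error terms are multiples of
    the squared H^1 distance because the weight is bounded and
    F(xi) <= B |xi|.  One lets k tend to infinity, then t to 0. *)
Lemma H10_weighted_le (w : 'rV[R]_n -> R) (K : R) :
  measurable_fun Omega w -> (forall x, 0 <= w x) ->
  (forall x, Omega x -> w x <= K) -> 0 <= K ->
  (forall phi, test_function Omega phi ->
    (\int[mu]_(x in Omega) (w x * phi x ^+ 2)%:E <=
     \int[mu]_(x in Omega) (F (grad phi x) ^+ 2)%:E)%E) ->
  (\int[mu]_(x in Omega) (w x * u x ^+ 2)%:E <=
   \int[mu]_(x in Omega) (F (Du x) ^+ 2)%:E)%E.
Proof.
move=> mw w0 wK K0 H.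
have [_ [phi [tphi phi0]]] := uP.
set b := (X in (_ <= X)%E).
pose delta k := (\int[mu]_(x in Omega)
       ((phi k x - u x) ^+ 2 + enorm (grad (phi k) x - Du x) ^+ 2)%:E)%E.
have b0 : (0 <= b)%E by apply: integral_ge0 => x _; rewrite lee_fin sqr_ge0.
have bfin : b \is a fin_num by rewrite ge0_fin_numE// integral_aniso_Du_lty.
have main t k : 0 < t -> (\int[mu]_(x in Omega) (w x * u x ^+ 2)%:E <=
   ((1 + t) ^+ 2)%:E * b +
   ((1 + t) * ((1 + t^-1) * B ^+ 2) + (1 + t^-1) * K)%:E * delta k)%E.
  move=> t0.
  have t1 : 0 <= 1 + t by rewrite addr_ge0// ltW.
  have tV1 : 0 <= 1 + t^-1 by rewrite addr_ge0// invr_ge0 ltW.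
  have [cphi dphi cdphi] := test_functionP (tphi k).
  have mphi : measurable_fun Omega (phi k).
    by apply: measurable_funTS; exact: continuous_measurable_rV.
  have mgrad : measurable_fun Omega (grad (phi k)).
    by apply: measurable_funTS; exact: measurable_grad.
  have mdiff : measurable_fun Omega (fun x => phi k x - u x).
    exact: measurable_funB.
  have mgdiff : measurable_fun Omega (fun x => enorm (grad (phi k) x - Du x)).
    have mN := continuous_measurable_rV (@enorm_continuous R n).
    apply: (measurableT_comp mN); apply: measurable_fun_rV_on => // i.
    rewrite (_ : (fun x => _) = (fun x => grad (phi k) x ord0 i - Du x ord0 i)).
      apply: measurable_funB.
        exact: (measurableT_comp (@measurable_coord R n i) mgrad).
      exact: (measurableT_comp (@measurable_coord R n i) mDu).
    by apply/funext => x; rewrite !mxE.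
  have md : measurable_fun Omega
      (fun x => (phi k x - u x) ^+ 2 + enorm (grad (phi k) x - Du x) ^+ 2).
    by apply: measurable_funD; exact: measurable_funX.
  have d0 x : 0 <= (phi k x - u x) ^+ 2 + enorm (grad (phi k) x - Du x) ^+ 2.
    by rewrite addr_ge0 ?sqr_ge0.
  have mFg : measurable_fun Omega (fun x => F (grad (phi k) x) ^+ 2).
    by apply: measurable_funX; exact: measurable_aniso_on.
  have mFD : measurable_fun Omega (fun x => F (Du x) ^+ 2).
    by apply: measurable_funX; exact: measurable_aniso_on.
  have mwp (v : 'rV[R]_n -> R) : measurable_fun Omega v ->
      measurable_fun Omega (fun x => w x * v x ^+ 2).
    by move=> mv; apply: measurable_funM => //; exact: measurable_funX.
  have E1 : (\int[mu]_(x in Omega) (w x * u x ^+ 2)%:E <=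
      (1 + t)%:E * \int[mu]_(x in Omega) (w x * phi k x ^+ 2)%:E +
      ((1 + t^-1) * K)%:E * delta k)%E.
    apply: ge0_integral_lin_le => //; try exact: mwp.
    - by move=> x; rewrite mulr_ge0 ?sqr_ge0.
    - by move=> x; rewrite mulr_ge0 ?sqr_ge0.
    - exact: mulr_ge0.
    - move=> x Ox.
      have := young (phi k x) (u x - phi k x) t0.
      rewrite (addrC (phi k x)) subrK -(opprB (phi k x)) sqrrN => Y.
      apply: le_trans (ler_wpM2l (w0 x) Y) _.
      rewrite mulrDr; apply: lerD; first by rewrite mulrCA.
      rewrite mulrCA -mulrA ler_wpM2l// ler_pM ?sqr_ge0 ?wK//.
      by rewrite lerDl sqr_ge0.
  have E2 : (\int[mu]_(x in Omega) (F (grad (phi k) x) ^+ 2)%:E <=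
      (1 + t)%:E * b + ((1 + t^-1) * B ^+ 2)%:E * delta k)%E.
    apply: ge0_integral_lin_le => //; try by move=> x; exact: sqr_ge0.
    - by rewrite mulr_ge0 ?sqr_ge0.
    - move=> x Ox.
      apply: (@le_trans _ _ ((F (Du x) + B * enorm (grad (phi k) x - Du x)) ^+ 2)).
        have Fg : F (grad (phi k) x) <= F (Du x) + B * enorm (grad (phi k) x - Du x).
          rewrite -{1}(subrK (Du x) (grad (phi k) x)) addrC.
          by apply: le_trans (anisoD FP _ _) _; rewrite lerD2l F_le_enorm.
        by rewrite lerXn2r ?nnegrE ?(aniso_ge0 FP)// (le_trans _ Fg)// (aniso_ge0 FP).
      apply: le_trans (young _ _ t0) _; rewrite lerD2l exprMn mulrA.
      apply: ler_wpM2l; first by rewrite mulr_ge0 ?sqr_ge0.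
      by rewrite lerDr sqr_ge0.
  apply: (le_trans E1).
  have t1e : (0 <= (1 + t)%:E)%E by rewrite lee_fin.
  apply: (@le_trans _ _ ((1 + t)%:E * ((1 + t)%:E * b + ((1 + t^-1) * B ^+ 2)%:E * delta k) +
    ((1 + t^-1) * K)%:E * delta k)%E).
    by rewrite leeD2r// lee_wpmul2l// (le_trans (H _ (tphi k))).
  have dk0 : (0 <= delta k)%E by apply: integral_ge0 => x _; rewrite lee_fin.
  rewrite ge0_muleDr; last 2 first.
  - by rewrite mule_ge0.
  - by rewrite mule_ge0// lee_fin mulr_ge0 ?sqr_ge0.
  rewrite !muleA -!EFinM -expr2 -addeA -ge0_muleDl -?EFinD//.
  + by rewrite lee_fin; do 2 (apply: mulr_ge0 => //); exact: sqr_ge0.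
  + by rewrite lee_fin mulr_ge0.
have step t : 0 < t -> (\int[mu]_(x in Omega) (w x * u x ^+ 2)%:E <=
   ((1 + t) ^+ 2)%:E * b)%E.
  move=> t0; set C := (1 + t) * ((1 + t^-1) * B ^+ 2) + (1 + t^-1) * K.
  have C0 : 0 <= C.
    have t1 : 0 <= 1 + t by rewrite addr_ge0// ltW.
    have tV1 : 0 <= 1 + t^-1 by rewrite addr_ge0// invr_ge0 ltW.
    rewrite addr_ge0//; last exact: mulr_ge0.
    by do 2 (apply: mulr_ge0 => //); exact: sqr_ge0.
  have cv : (((1 + t) ^+ 2)%:E * b + C%:E * delta k)%E @[k --> \oo] -->
      (((1 + t) ^+ 2)%:E * b + C%:E * 0)%E.
    apply: cvgeD; first by rewrite mule0 fin_num_adde_defl.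
      exact: cvg_cst.
    by apply: cvgeZl.
  rewrite mule0 adde0 in cv.
  by apply: cvge_ge cv; apply: nearW => k; exact: main.
apply/lee_addgt0Pr => e e0.
have r0 : 0 <= fine b by exact: fine_ge0.
(* For t <= 1, (1 + t)^2 - 1 <= 3 t. *)
pose t := Num.min 1 (e / (3 * (fine b + 1))).
have b1 : 0 < 3 * (fine b + 1) by rewrite mulr_gt0// ltr_wpDl.
have t0 : 0 < t by rewrite lt_min ltr01 divr_gt0.
have t1 : t <= 1 by rewrite ge_min lexx.
apply: (le_trans (step _ t0)); rewrite -(fineK bfin) -EFinM -EFinD lee_fin.
have tb : t * (3 * (fine b + 1)) <= e.
  by rewrite -ler_pdivlMr// ge_min lexx orbT.
have tt : t ^+ 2 * fine b <= t * fine b by rewrite ler_wpM2r// expr2 ler_piMl// ltW.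
have tb0 : 0 <= t * fine b by rewrite mulr_ge0// ltW.
have -> : (1 + t) ^+ 2 * fine b = fine b + 2 * (t * fine b) + t ^+ 2 * fine b by ring.
have : t * (3 * (fine b + 1)) = 3 * (t * fine b) + 3 * t by ring.
by lra.
Qed.

End H10_limit.

Section hardy_domain.
Context {R : realType} {n : nat} (alpha1 : R) (F : 'rV[R]_n -> R).
Variable Omega : set 'rV[R]_n.
Hypothesis alpha1_gt0 : 0 < alpha1.
Hypothesis FP : anisotropic_norm alpha1 F.
Hypothesis OP : domain Omega.
Hypothesis cO : convex_set Omega.
Hypothesis bO : bounded_set Omega.
Local Notation mu := (lebesgue_rV n).
Local Notation d := (anisotropic_dist F Omega).
Variables (u : 'rV[R]_n -> R) (Du : 'rV[R]_n -> 'rV[R]_n).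
Hypothesis uP : H10 Omega u Du.

Let mO : measurable Omega.
Proof. by apply: open_measurable_rV; case: OP. Qed.

(** The weight W(d + e_k) with L = 2K is at least
    1/(4 (d + e_k)^2) + 1/(64 K^2) as soon as e_k <= K; Fatou's lemma lets e_k
    tend to 0. *)
Lemma hardy_H10 (K : R) : 0 < K -> (forall x, Omega x -> d x <= K) ->
  (\int[mu]_(x in Omega)
     (4^-1 * (u x ^+ 2 / d x ^+ 2) + (64 * K ^+ 2)^-1 * u x ^+ 2)%:E <=
   \int[mu]_(x in Omega) (F (Du x) ^+ 2)%:E)%E.
Proof.
move=> K0 dK.
pose e k : R := K / k.+1%:R.
have e0 k : 0 < e k by rewrite divr_gt0.
have eK k : e k <= K by rewrite ler_pdivrMr// ler_peMr ?(ltW K0)// ler1n.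
have ecvg : e @ \oo --> 0.
  have := cvgM (@cvg_cst _ K _ \oo _) (@cvg_harmonic R).
  by rewrite mulr0; exact.
have cd := aniso_dist_continuous alpha1_gt0 FP OP.
have d0 x : 0 <= d x by exact: aniso_dist_ge0 alpha1_gt0 FP OP x.
have L0 : 0 < 2 * K by rewrite mulr_gt0.
have mdT : measurable_fun setT d by exact: continuous_measurable_rV.
have mu_ : measurable_fun Omega u by case: uP => -[[]].
have mw k : measurable_fun Omega (fun x => hardy_weight (2 * K) (d x + e k)).
  apply: measurable_funTS; apply: (measurableT_comp (measurable_hardy_weight _)).
  exact: measurable_funD.
have step k : (\int[mu]_(x in Omega) (hardy_weight (2 * K) (d x + e k) * u x ^+ 2)%:E <=
   \int[mu]_(x in Omega) (F (Du x) ^+ 2)%:E)%E.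
  have de x : 0 < d x + e k by rewrite ltr_wpDl.
  apply: (@H10_weighted_le R n alpha1 F FP Omega mO u Du uP _ (hardy_weight (2 * K) (e k))) => //.
  - by move=> x; exact/ltW/hardy_weight_gt0.
  - by move=> x _; apply: hardy_weight_decr => //; rewrite lerDr.
  - exact/ltW/hardy_weight_gt0.
  - by move=> phi tphi; exact: (hardy_test alpha1_gt0 FP OP cO bO tphi (e0 k) L0).
pose f k x : R := 4^-1 * (u x ^+ 2 / (d x + e k) ^+ 2) + (64 * K ^+ 2)^-1 * u x ^+ 2.
have mf k : measurable_fun Omega (f k).
  apply: measurable_funD; apply: measurable_funM => //; last exact: measurable_funX.
  apply: measurable_funM; first exact: measurable_funX.
  apply: measurable_funTS; apply: (measurableT_comp measurable_invr).
  by apply: measurable_funX; exact: measurable_funD.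
have f0 k x : 0 <= f k x.
  apply: addr_ge0; apply: mulr_ge0; rewrite ?invr_ge0 ?sqr_ge0//.
    by rewrite divr_ge0 ?sqr_ge0.
  by apply: mulr_ge0 => //; exact: sqr_ge0.
have fle k : (\int[mu]_(x in Omega) (f k x)%:E <=
   \int[mu]_(x in Omega) (F (Du x) ^+ 2)%:E)%E.
  apply: le_trans (step k); apply: ge0_le_integral => //.
  - by move=> x _; rewrite lee_fin.
  - exact/measurable_EFinP.
  - by apply/measurable_EFinP; apply: measurable_funM => //; exact: measurable_funX.
  move=> x Ox; rewrite lee_fin /f.
  have de : 0 < d x + e k by rewrite ltr_wpDl.
  have dL : d x + e k <= 2 * K by rewrite mulr_natl mulr2n lerD// dK.
  have := ler_wpM2r (sqr_ge0 (u x)) (hardy_weight_ge de dL).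
  apply: le_trans; rewrite le_eqVlt; apply/orP; left; apply/eqP.
  by field; rewrite !gt_eqF.
have fcvg x : Omega x -> (fun k => (f k x)%:E) @ \oo -->
    (4^-1 * (u x ^+ 2 / d x ^+ 2) + (64 * K ^+ 2)^-1 * u x ^+ 2)%:E.
  move=> Ox; have dx := aniso_dist_gt0 alpha1_gt0 FP OP Ox.
  apply: cvg_EFin; first exact: nearW.
  apply: cvgD; last exact: cvg_cst.
  apply: cvgM; first exact: cvg_cst.
  apply: cvgM; first exact: cvg_cst.
  apply: cvgV; first by rewrite gt_eqF// exprn_gt0.
  have dcvg : (fun k => d x + e k) @ \oo --> d x.
    have := cvgD (@cvg_cst _ (d x) _ \oo _) ecvg.
    by rewrite addr0; exact.
  by rewrite expr2; under eq_fun do rewrite expr2; exact: cvgM.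
rewrite (eq_integral (fun x => limn_einf (fun k => (f k x)%:E))); last first.
  move=> x /[!inE] Ox; rewrite is_cvg_limn_einfE; last exact: cvgP (fcvg x Ox).
  by apply/esym/cvg_lim => //; exact: fcvg.
apply: (le_trans (fatou mu mO (fun k => (measurable_EFinP _ _).2 (mf k)) _)).
  by move=> k x _; rewrite lee_fin.
rewrite limn_einf_lim; apply: lime_le; first exact: is_cvg_einfs.
apply: nearW => k; apply: le_trans (fle k).
by apply: ereal_inf_lbound; exists k => /=.
Qed.

End hardy_domain.

(** * The improved anisotropic Hardy inequality *)

Unset Implicit Arguments.

Theorem mainTheorem3 (R : realType) (n : nat) (alpha1 : R) :
  0 < alpha1 ->
  exists C : R, 0 < C /\
    forall F : 'rV[R]_n -> R, anisotropic_norm alpha1 F ->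
    forall Omega : set 'rV[R]_n,
      domain Omega -> bounded_set Omega -> convex_set Omega ->
    forall (u : 'rV[R]_n -> R) (Du : 'rV[R]_n -> 'rV[R]_n), H10 Omega u Du ->
      (\int[lebesgue_rV n]_(x in Omega) (F (Du x) ^+ 2)%:E
       - (1 / 4)%:E * \int[lebesgue_rV n]_(x in Omega)
                        (`|u x| ^+ 2 / anisotropic_dist F Omega x ^+ 2)%:E
       >= C%:E * lebesgue_rV n Omega `^ (- (2 / n%:R))
          * \int[lebesgue_rV n]_(x in Omega) (`|u x| ^+ 2)%:E)%E.
Proof.
(* R^0 has no domain: every subset of a point has empty boundary. *)
move=> alpha1_gt0; have [n0|n_gt0] := posnP n.
  exists 1; split=> // F FP Omega OP.
  by exfalso; move: (domain_dim_gt0 OP); rewrite {1}n0.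
have nR : 0 < n%:R :> R by rewrite ltr0n.
(* This is (64 K^2)^-1 |Omega|^(2/n) for the bound K below on the distance. *)
exists (alpha1 ^+ 2 / (16 * n%:R ^+ 2)); split.
  by rewrite divr_gt0 ?mulr_gt0 ?exprn_gt0.
move=> F FP Omega OP bO cO u Du uP.
have mO : measurable Omega by apply: open_measurable_rV; case: OP.
pose V := fine (lebesgue_rV n Omega).
have VE : lebesgue_rV n Omega = V%:E.
  by rewrite fineK// ge0_fin_numE// domain_volume_lty.
have V0 : 0 < V.
  by rewrite -lte_fin -VE; exact: domain_volume_gt0 alpha1_gt0 FP OP bO.
pose K := n%:R / (2 * alpha1) * V `^ n%:R^-1.
have K0 : 0 < K by rewrite mulr_gt0 ?divr_gt0 ?mulr_gt0// powR_gt0.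
have H := hardy_H10 alpha1_gt0 FP OP cO bO uP K0
  (aniso_dist_le_volume alpha1_gt0 FP OP bO).
have KE : (64 * K ^+ 2)^-1 = alpha1 ^+ 2 / (16 * n%:R ^+ 2) * V `^ (- (2 / n%:R)).
  have W0 : V `^ n%:R^-1 != 0 by rewrite gt_eqF// powR_gt0.
  rewrite powRN [2 / _]mulrC powRrM powR_mulrn ?powR_ge0// /K.
  by field; rewrite W0 !gt_eqF.
have mu_ : measurable_fun Omega (fun x => u x ^+ 2).
  by apply: measurable_funX; case: uP => -[[]].
have md2 : measurable_fun Omega (fun x => u x ^+ 2 / anisotropic_dist F Omega x ^+ 2).
  apply: measurable_funM => //; apply: measurable_funTS.
  apply: (measurableT_comp measurable_invr); apply: measurable_funX.
  exact: continuous_measurable_rV (aniso_dist_continuous alpha1_gt0 FP OP).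
under [X in (_ - _ * X)%E]eq_integral do rewrite real_normK ?num_real//.
under [X in (_ * X <= _)%E]eq_integral do rewrite real_normK ?num_real//.
rewrite VE poweR_EFin -EFinM -KE div1r.
set b := (\int[_]_(x in _) (F _ ^+ 2)%:E)%E in H *.
set I := (X in (_ - _ * X)%E).
set J := (X in (_ * X <= _)%E).
have I0 : (0 <= I)%E by apply: integral_ge0 => x _; rewrite lee_fin divr_ge0 ?sqr_ge0.
have J0 : (0 <= J)%E by apply: integral_ge0 => x _; rewrite lee_fin sqr_ge0.
have HIJ : (4^-1%:E * I + (64 * K ^+ 2)^-1%:E * J <= b)%E.
  apply: le_trans H; rewrite /I /J -!ge0_integralZl_EFin//.
  - rewrite -ge0_integralD//.
    + move=> x _; rewrite -EFinM lee_fin; apply: mulr_ge0; first by rewrite invr_ge0.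
      by rewrite divr_ge0 ?sqr_ge0.
    + by apply/measurable_EFinP; exact: measurable_funM.
    + move=> x _; rewrite -EFinM lee_fin; apply: mulr_ge0; last exact: sqr_ge0.
      by rewrite invr_ge0; apply: mulr_ge0 => //; exact: sqr_ge0.
    + by apply/measurable_EFinP; exact: measurable_funM.
  - by move=> x _; rewrite lee_fin sqr_ge0.
  - exact/measurable_EFinP.
  - by rewrite invr_ge0; apply: mulr_ge0 => //; exact: sqr_ge0.
  - by move=> x _; rewrite lee_fin divr_ge0 ?sqr_ge0.
  - exact/measurable_EFinP.
have Kinv : (0 <= (64 * K ^+ 2)^-1%:E)%E.
  by rewrite lee_fin invr_ge0; apply: mulr_ge0 => //; exact: sqr_ge0.
have Ifin : (4^-1%:E * I)%E \is a fin_num.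
  rewrite ge0_fin_numE; last by rewrite mule_ge0// lee_fin invr_ge0.
  apply: le_lt_trans (integral_aniso_Du_lty FP mO uP).
  by apply: le_trans HIJ; rewrite leeDl// mule_ge0.
by rewrite leeBrDl.
Qed.
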